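(* Let $\mathbf{k}$ be a commutative ring with $1$, $V=\mathbf{k}^n$, $S=\mathbf{k}[x_1,\ldots,x_n]=S(V)$. Fix integers $d,r\geq 1$, and let $R=S^{(d)}$ and $M=S^{(\geq r,d)}$. Let $\partial_0:R\otimes_{\mathbf{k}}\mathbb{S}^{\sigma(r)}(V)=R\otimes_{\mathbf{k}}S_r\twoheadrightarrow M$ be the map given by multiplication in $S$. Then $\partial_0$ starts a $GL(V)$-equivariant minimal $R$-free resolution of $M$ $$R\otimes_{\mathbf{k}}\mathbb{S}^{\sigma(r)}(V)\xleftarrow{\partial_1}R\otimes_{\mathbf{k}}\mathbb{S}^{\sigma(d,r)}(V)\xleftarrow{\partial_2}\cdots\leftarrow R\otimes_{\mathbf{k}}\mathbb{S}^{\sigma(d^{i-1},r)}(V)\xleftarrow{\partial_i}R\otimes_{\mathbf{k}}\mathbb{S}^{\sigma(d^i,r)}(V)\leftarrow\cdots$$ obtained by restricting the base ring in the complex of ribbons $(\mathscr{R}_\bullet,\partial)$ from $S$ to $R$, and then taking only the summands indexed by compositions of the form $\alpha=(d^i,r)$ for $i=0,1,2,\ldots$; that is, for $i\geq 1$, $\partial_i$ is the restriction of the map $s\otimes(s_1\otimes s_2\otimes\cdots\otimes s_{i+1})\mapsto s\cdot s_1\otimes(s_2\otimes\cdots\otimes s_{i+1})$. Here the free $R$-module in homological degree $i$ has its basis elements in degree $di+r$, so it is actually $R\otimes_{\mathbf{k}}\mathbb{S}^{\sigma(d^i,r)}(V)(-(di+r))$.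
   Context: Let $x_1,\ldots,x_n$ be the $\mathbf{k}$-basis of $V$. $S=\bigoplus_j S_j$ has the standard grading, with $S_j=S^j(V)$ the $j$th symmetric power, and $GL(V)\cong GL_n(\mathbf{k})$ acts on $S$ by $\mathbf{k}$-algebra automorphisms extending its action on $V$. The $d$th Veronese subalgebra is $S^{(d)}=\bigoplus_{j\equiv 0 \bmod d}S_j$, and $S^{(\geq r,d)}=\bigoplus_{j\ge r,\ j\equiv r \bmod d}S_j$, an $S^{(d)}$-submodule of $S$. Gradings are those inherited from $S$. ''Minimal'' means that all matrix entries of the differentials $\partial_i$, $i\ge1$, lie in $R_+=S^{(\geq d,d)}$. ''$GL(V)$-equivariant'' means that all maps commute with $GL(V)$, acting diagonally on $R\otimes_{\mathbf{k}}\mathbb{S}^{D}(V)$. Schur functors: for a finite diagram $D$ of cells (matrix-style coordinates, rows listed bottom-to-top $R_1,\dots,R_p$, columns listed left-to-right $C_1,\dots,C_c$), $\mathbb{S}^D(V)$ is the $GL(V)$-submodule of $S^{|R_1|}(V)\otimes_{\mathbf{k}}\cdots\otimes_{\mathbf{k}} S^{|R_p|}(V)$ that is the image of the composite $$\wedge^{|C_1|}(V)\otimes\cdots\otimes\wedge^{|C_c|}(V)\to V^{\otimes |D|}\to S^{|R_1|}(V)\otimes\cdots\otimes S^{|R_p|}(V),$$ where tensor positions of $V^{\otimes|D|}$ are indexed by cells of $D$, the first map is the tensor product over columns of the antisymmetrizations $v_1\wedge\cdots\wedge v_\ell\mapsto\sum_{w\in\mathfrak{S}_\ell}\operatorname{sgn}(w)\,v_{w(1)}\otimes\cdots\otimes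 v_{w(\ell)}$ (placed in the cells of that column from top to bottom), and the second map multiplies together the entries in each row. Ribbons: for a composition (sequence of positive integers) $\alpha=(\alpha_1,\ldots,\alpha_\ell)$, $\sigma(\alpha)$ is the ribbon skew diagram whose row sizes from bottom to top are $\alpha_1,\ldots,\alpha_\ell$, each row's rightmost cell lying in the same column as the leftmost cell of the row just above it, and no other column overlaps. Thus $\mathbb{S}^{\sigma(\alpha)}(V)\subseteq S^{\alpha_1}(V)\otimes\cdots\otimes S^{\alpha_\ell}(V)$. $(d^i,r)$ denotes $(d,\ldots,d,r)$ with $i$ copies of $d$. Complex of ribbons: the $S$-modules $\mathscr{R}_\ell=S\otimes_{\mathbf{k}}\bigoplus_{\alpha}\mathbb{S}^{\sigma(\alpha)}(V)\subseteq S\otimes_{\mathbf{k}}S^{\otimes_{\mathbf{k}}\ell}$ (sum over compositions $\alpha$ of length $\ell$), with $\partial$ the restriction of $s\otimes(s_1\otimes\cdots\otimes s_\ell)\mapsto s s_1\otimes(s_2\otimes\cdots\otimes s_\ell)$, which maps $S\otimes_{\mathbf{k}}\mathbb{S}^{\sigma(\alpha_1,\ldots,\alpha_\ell)}(V)$ into $S\otimes_{\mathbf{k}}\mathbb{S}^{\sigma(\alpha_2,\ldots,\alpha_\ell)}(V)$. *)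

(* Defs.v *)
From HB Require Import structures.
From mathcomp Require Import all_boot all_order all_algebra all_fingroup.
From mathcomp Require Export mpoly.

Set Implicit Arguments.
Unset Strict Implicit.
Unset Printing Implicit Defensive.

Import GRing.Theory.

Local Open Scope ring_scope.

(* The symmetric algebra S = S(V) of V = k^n.  Vectors of V are row vectors of
   coordinates in the basis x_0, ..., x_(n-1). *)
Notation sym k n := {mpoly k[n]} (only parsing).

(* The m-fold tensor power of S over k, as the polynomial ring in the variables
   x_(a, j) with a < m and j < n: the a-th tensor factor is the copy of S in the
   variables x_(a, _), see [place], [tens], [tens_mon] and [mon_tens]. *)
Notation tpow k n m := {mpoly k[m * n]} (only parsing).

Section Tensor.
Context {k : comNzRingType} {n : nat}.
Implicit Types (m l : nat) (s p : sym k n).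

Definition var m (a : 'I_m) (j : 'I_n) : tpow k n m := 'X_(mxvec_index a j).

(* The algebra morphism x_(a, j) |-> P a j. *)
Definition subst m N (P : 'M[{mpoly k[N]}]_(m, n)) (t : tpow k n m) :
  {mpoly k[N]} := t \mPo [tuple mxvec P 0 i | i < m * n].

(* place a s = 1 (x) ... (x) s (x) ... (x) 1, with s in position a. *)
Definition place m (a : 'I_m) (s : sym k n) : tpow k n m :=
  s \mPo [tuple var a j | j < n].

(* tens s = s_0 (x) ... (x) s_(m-1). *)
Definition tens m (s : 'I_m -> sym k n) : tpow k n m :=
  \prod_(a < m) place a (s a).

Definition shift m : tpow k n m -> tpow k n m.+1 :=
  subst (\matrix_(a < m, j < n) var (lift ord0 a) j).

(* s (x) t for s in S and t in the m-fold tensor power. *)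
Definition tcons m (s : sym k n) (t : tpow k n m) : tpow k n m.+1 :=
  place ord0 s * shift t.

(* The S-module structure given by multiplication on the first factor. *)
Definition lscale m (s : sym k n) (t : tpow k n m.+1) : tpow k n m.+1 :=
  place ord0 s * t.

(* s (x) s_1 (x) t |-> s s_1 (x) t, see [ribbon_diffE]. *)
Definition ribbon_diff m : tpow k n m.+2 -> tpow k n m.+1 :=
  subst (\matrix_(a < m.+2, j < n) var (odflt ord0 (unlift ord0 a)) j).

(* s (x) s_1 |-> s s_1, see [mult_mapE]. *)
Definition mult_map : tpow k n 2 -> sym k n :=
  subst (\matrix_(a < 2, j < n) 'X_j).

(* k is not assumed to be a unit ring, so that unitmx is not available. *)
Definition isGL (g : 'M[k]_n) : Prop :=
  exists2 h : 'M[k]_n, g *m h = 1%:M & h *m g = 1%:M.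

Definition gl_sym (g : 'M[k]_n) (s : sym k n) : sym k n :=
  s \mPo [tuple \sum_(i < n) g i j *: 'X_i | j < n].

(* The diagonal action, see [gl_tens]. *)
Definition gl_act (g : 'M[k]_n) m : tpow k n m -> tpow k n m :=
  subst (\matrix_(a < m, j < n) \sum_(i < n) g i j *: var a i).

Definition span (U : lmodType k) (E : U -> Prop) (x : U) : Prop :=
  exists (N : nat) (c : 'I_N -> k) (e : 'I_N -> U),
    (forall i, E (e i)) /\ x = \sum_(i < N) c i *: e i.

(* S^(d), S^(>= r, d) and, below, R_+ = S^(>= d, d), by the degrees of the
   monomials that occur. *)
Definition veronese (d : nat) (s : sym k n) : Prop :=
  forall u, u \in msupp s -> (mdeg u = 0 %[mod d])%N.

Definition veronese_ge (r d : nat) (s : sym k n) : Prop :=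
  forall u, u \in msupp s -> (r <= mdeg u)%N /\ (mdeg u = r %[mod d])%N.

(* R (x) W for R = S^(d) and W a k-submodule of the m-fold tensor power.  As R
   is a direct summand of the k-free module S and S^(x)m is k-free, the map
   from R (x) W to the (m+1)-fold tensor power is injective for all W, so that
   R (x) W is its image. *)
Definition vtensor (d m : nat) (W : tpow k n m -> Prop) :
    tpow k n m.+1 -> Prop :=
  span (fun t => exists s w, [/\ veronese d s, W w & t = tcons s w]).

(* A diagram is a finite set of cells (i, j) in p rows, numbered from the top,
   and c columns, numbered from the left.  The rows are listed bottom to top,
   so that row i has tensor position rev_ord i. *)
Section Schur.
Variables (p c : nat) (D : {set 'I_p * 'I_c}).

Definition column (j : 'I_c) : {set 'I_p} := [set i | (i, j) \in D].

Definition linear_form (v : 'rV[k]_n) : sym k n := \sum_(i < n) v 0 i *: 'X_i.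

(* The image of v_1 /\ ... /\ v_l under the antisymmetrization of column j:
   as enum_val is increasing, enum_val t is the row of the t-th cell from the
   top. *)
Definition antisym (j : 'I_c) (v : 'I_#|column j| -> 'rV[k]_n) : tpow k n p :=
  \sum_(w : 'S_#|column j|)
    (-1) ^+ w *: \prod_(t < #|column j|)
                   place (rev_ord (enum_val t)) (linear_form (v (w t))).

(* The exterior powers are spanned by the products v_1 /\ ... /\ v_l, and the
   product over the columns multiplies together the entries in each row. *)
Definition schur : tpow k n p -> Prop :=
  span (fun t => exists v : forall j : 'I_c, 'I_#|column j| -> 'rV[k]_n,
                   t = \prod_(j < c) antisym (v j)).
End Schur.

(* F is a submodule of the (m+1)-fold tensor power that is free over S^(d) with
   basis b. *)
Definition is_basis (d m : nat) (F : tpow k n m.+1 -> Prop) (N : nat)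
    (b : 'I_N -> tpow k n m.+1) : Prop :=
  (forall t, F t <-> exists2 c : 'I_N -> sym k n,
       (forall j, veronese d (c j)) & t = \sum_(j < N) lscale (c j) (b j)) /\
  (forall c : 'I_N -> sym k n, (forall j, veronese d (c j)) ->
     \sum_(j < N) lscale (c j) (b j) = 0 -> forall j, c j = 0).

End Tensor.

(* For a composition alpha (all parts positive): row a, counted from the bottom,
   has its leftmost cell in column sum_(b < a) (alpha_b - 1) and its rightmost
   cell in column sum_(b <= a) (alpha_b - 1). *)
Definition ribbon (l : nat) (alpha : l.-tuple nat) :
    {set 'I_l * 'I_(\sum_(b < l) (tnth alpha b).-1).+1} :=
  [set x : 'I_l * 'I_(\sum_(b < l) (tnth alpha b).-1).+1 |
    let a := rev_ord x.1 in
    (\sum_(b < l | b < a) (tnth alpha b).-1 <= x.2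
       <= \sum_(b < l | b <= a) (tnth alpha b).-1)%N].

(* (d^i, r) *)
Definition comp_dr (d i r : nat) : (i.+1).-tuple nat :=
  [tuple of rcons (nseq_tuple i d) r].

(* R (x) S^(sigma(d^i, r))(V) *)
Definition res_term (k : comNzRingType) (n d r i : nat) :
    tpow k n i.+2 -> Prop :=
  vtensor d (schur (ribbon (comp_dr d i r))).

Section Facts.
Context {k : comNzRingType} {n : nat}.

Lemma subst_var m N (P : 'M[{mpoly k[N]}]_(m, n)) a j :
  subst P (var a j) = P a j.
Proof. by rewrite /subst /var comp_mpolyXU -tnth_nth tnth_mktuple mxvecE. Qed.

Lemma subst_place m N (P : 'M[{mpoly k[N]}]_(m, n)) a (s : sym k n) :
  subst P (place a s) = s \mPo [tuple P a j | j < n].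
Proof.
rewrite /place (comp_mpolyEX s) (comp_mpolyEX s [tuple P a j | j < n]).
rewrite /subst !raddf_sum; apply: eq_bigr => u _.
rewrite /= comp_mpolyZ !comp_mpolyX rmorph_prod; congr (_ *: _).
apply: eq_bigr => j _; rewrite rmorphXn !tnth_mktuple.
by congr (_ ^+ _); apply: subst_var.
Qed.

Lemma subst_shift m N (P : 'M[{mpoly k[N]}]_(m.+1, n)) (t : tpow k n m) :
  subst P (shift t) = subst (\matrix_(a < m, j < n) P (lift ord0 a) j) t.
Proof.
rewrite /shift {2 3}/subst (comp_mpolyEX t) [in RHS](comp_mpolyEX t).
rewrite /subst !raddf_sum; apply: eq_bigr => u _.
rewrite /= comp_mpolyZ !comp_mpolyX rmorph_prod; congr (_ *: _).
apply: eq_bigr => i _; rewrite rmorphXn !tnth_mktuple.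
case/mxvec_indexP: i => a j; rewrite !mxvecE !mxE.
by congr (_ ^+ _); apply: subst_var.
Qed.

Lemma substM m N (P : 'M[{mpoly k[N]}]_(m, n)) (t u : tpow k n m) :
  subst P (t * u) = subst P t * subst P u.
Proof. exact: rmorphM. Qed.

Lemma ribbon_diffE m (s s1 : sym k n) (t : tpow k n m) :
  ribbon_diff (tcons s (tcons s1 t)) = tcons (s * s1) t.
Proof.
rewrite /ribbon_diff /tcons substM subst_place subst_shift substM.
rewrite subst_place subst_shift mulrA; congr (_ * _).
  rewrite [in RHS]/place rmorphM /=; congr (_ * _).
    congr (_ \mPo _); apply: eq_from_tnth => j.
    by rewrite !tnth_mktuple mxE unlift_none.
  congr (_ \mPo _); apply: eq_from_tnth => j.
  by rewrite !tnth_mktuple !mxE liftK.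
by congr (subst _ t); apply/matrixP => a j; rewrite !mxE liftK.
Qed.

Lemma mult_mapE (s s1 : sym k n) :
  mult_map (tcons s (place ord0 s1)) = s * s1.
Proof.
rewrite /mult_map /tcons substM subst_place subst_shift subst_place.
by congr (_ * _); rewrite -[RHS]comp_mpoly_id; congr (_ \mPo _);
  apply: eq_from_tnth => j; rewrite !tnth_mktuple !mxE.
Qed.

Lemma gl_tens (g : 'M[k]_n) m (s : 'I_m -> sym k n) :
  gl_act g (tens s) = tens (fun a => gl_sym g (s a)).
Proof.
rewrite /tens /gl_act /subst rmorph_prod; apply: eq_bigr => a _.
rewrite [LHS]subst_place /place /gl_sym (comp_mpolyEX (s a)).
rewrite (comp_mpolyEX (s a)) !raddf_sum; apply: eq_bigr => u _.
rewrite /= comp_mpolyZ !comp_mpolyX rmorph_prod; congr (_ *: _).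
apply: eq_bigr => j _; rewrite rmorphXn !tnth_mktuple mxE; congr (_ ^+ _).
rewrite raddf_sum; apply: eq_bigr => i _.
by rewrite /= comp_mpolyZ comp_mpolyXU -tnth_nth tnth_mktuple.
Qed.

(* The monomials of tpow k n m are the tensors of m-tuples of monomials. *)
Lemma tens_mon m (u : 'X_{1..m * n}) :
  'X_[u] = tens (fun a : 'I_m =>
                   'X_[[multinom u (mxvec_index a j) | j < n]]) :> tpow k n m.
Proof.
rewrite /tens /place [LHS]mpolyXE_id.
under [RHS]eq_bigr => a _ do rewrite comp_mpolyX.
rewrite (reindex (fun x : 'I_m * 'I_n => mxvec_index x.1 x.2)) /=; last first.
  have [f fK Kf] := curry_mxvec_bij m n.
  by exists f => [[a j] _|i _]; [rewrite -[RHS]fK | rewrite -[RHS]Kf; case: (f i)].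
rewrite -(pair_bigA _ (fun a j => 'X_(mxvec_index a j) ^+ u (mxvec_index a j))) /=.
apply: eq_bigr => a _; apply: eq_bigr => j _.
by rewrite tnth_mktuple mnmE.
Qed.

Lemma mon_tens m (u : 'I_m -> 'X_{1..n}) :
  tens (fun a => 'X_[u a]) =
  'X_[[multinom (mxvec (\matrix_(a < m, j < n) u a j)) ord0 i | i < m * n]]
    :> tpow k n m.
Proof.
rewrite tens_mon /tens; apply: eq_bigr => a _; congr (place a (mpolyX _ _)).
by apply/mnmP => j; rewrite !mnmE mxvecE mxE.
Qed.

End Facts.

(* Main.v *)
Require Import Defs.
From HB Require Import structures.
From mathcomp Require Import all_boot all_order all_algebra all_fingroup.
From mathcomp Require Import zify ring.

Set Implicit Arguments.
Unset Strict Implicit.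
Unset Printing Implicit Defensive.

Import GRing.Theory.

Local Open Scope ring_scope.

(** The complex is exact because the ribbon modules are cut out by fusions.

    Fix a tensor power of S, and let fuse a multiply its a-th and (a+1)-st
    factors.  For a composition alpha with positive parts, the ribbon Schur
    module is the set of all t, homogeneous of degree alpha_a in the a-th
    factor for every a, that are killed by every fuse a.  One inclusion is
    immediate: adjacent rows of a ribbon share a column, and a column is a
    determinant (antisym_det), two rows of which become equal when the two
    factors are fused (schur_fuse).

    The converse is a straightening argument with a weight on monomials that
    rewards large variables in the bottom rows.  A monomial of a tensor power is
    a sequence of rows, that is, of multisets of variables.  Consider monomials
    u of maximal weight in an element t.
    - If t is killed by fuse a, then row a of u has a variable larger than some
      variable of row a+1 (descent_max): otherwise u would be the lightest of
      the monomials with the same fusion, hence the only one of these in t, and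
      its coefficient would survive in the fusion of t.
    - If u has such a descent at every a, then filling the ribbon with the rows
      of u in increasing order makes all columns strict, and by the
      rearrangement inequality the resulting product of determinants is u plus
      monomials of smaller weight (ribbon_tableau).
    So elements killed by all fusions can be reduced to 0 by subtracting
    multiples of elements of the ribbon module (straighten); nothing is divided
    by, so k can be any commutative ring.  The same argument, with the first
    factor S as coefficients, shows that the i-th term of the complex consists
    of the elements killed by all fusions but the first one, with a coefficient
    factor of degree divisible by d (res_termE), and that it is free on the
    tableaux (tcons_basis).

    The differential is the first fusion.  This makes it clear that it maps the
    terms into each other, squares to 0 and commutes with GL(V).  An element of
    its kernel is killed by all fusions, so it straightens along monomials u
    with descents everywhere.  In such a u the coefficient row is not empty, so
    it has degree at least d, and d of its variables, including one that takes
    part in the descent, can be split off to form a new bottom row of the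
    ribbon.  The generator of the next term belonging to this splitting has image
    u plus lower terms (ribbon_diff_tableau), whence exactness.  Surjectivity
    onto M is the same splitting of monomials.  Finally, the image of the
    differential has positive degree in the coefficient factor, because the row
    that is multiplied into it has degree d; in terms of bases this is
    minimality (res_minimal). *)

(* The k-span of a set of elements, not that of a finite sequence of vectors. *)
Local Notation span := Defs.span.

(** * Spans and supports *)

Section Span.
Variables (k : comNzRingType) (U : lmodType k).
Implicit Types (E W : U -> Prop) (x y : U).

Definition submodule W := W 0 /\ forall c x y, W x -> W y -> W (c *: x + y).

Lemma submoduleD W x y : submodule W -> W x -> W y -> W (x + y).
Proof. by case=> _ WD Wx Wy; rewrite -[x]scale1r; apply: WD. Qed.

Lemma submoduleZ W c x : submodule W -> W x -> W (c *: x).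
Proof. by case=> W0 WD Wx; rewrite -[_ *: x]addr0; apply: WD. Qed.

Lemma submoduleB W x y : submodule W -> W x -> W y -> W (x - y).
Proof.
by move=> Wsub Wx Wy; rewrite -scaleN1r addrC; case: Wsub => _; apply.
Qed.

Lemma submodule_sum W I (s : seq I) (P : pred I) (F : I -> U) :
  submodule W -> (forall i, P i -> W (F i)) -> W (\sum_(i <- s | P i) F i).
Proof.
move=> Wsub WF; elim/big_ind: _ => //; first by case: Wsub.
by move=> x y; apply: submoduleD.
Qed.

Lemma span_gen E x : E x -> span E x.
Proof.
move=> Ex; exists 1%N, (fun=> 1), (fun=> x); split=> //.
by rewrite big_ord1 scale1r.
Qed.

Lemma span_submodule E : submodule (span E).
Proof.
split=> [|c x y [N [a [e [Ee ->]]]] [N' [a' [e' [Ee' ->]]]]].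
  by exists 0%N, (fun=> 0), (fun=> 0); split=> [[]|]; rewrite ?big_ord0.
exists (N + N')%N, (fun i => match split i with inl j => c * a j | inr j => a' j end).
exists (fun i => match split i with inl j => e j | inr j => e' j end).
split=> [i|]; first by case: split.
rewrite big_split_ord scaler_sumr /=; congr (_ + _); apply: eq_bigr => i _.
  by rewrite (unsplitK (inl i)) scalerA.
by rewrite (unsplitK (inr i)).
Qed.

Lemma span_min E W x : submodule W -> (forall y, E y -> W y) -> span E x -> W x.
Proof.
move=> Wsub sEW [N [c [e [Ee ->]]]].
by apply: submodule_sum => // i _; apply: submoduleZ => //; apply: sEW.
Qed.

End Span.

Section Supported.
Variables (k : comNzRingType) (N : nat).
Implicit Types (P Q : 'X_{1..N} -> Prop) (p q : {mpoly k[N]}).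

Definition supported P p := forall u, u \in msupp p -> P u.

Lemma supported_submodule P : submodule (supported P).
Proof.
split=> [u|c p q Pp Pq u /msuppD_le]; first by rewrite msupp0.
by rewrite mem_cat => /orP[/msuppZ_le/Pp|/Pq].
Qed.

Lemma supportedX P u : P u -> supported P 'X_[k, u].
Proof. by move=> Pu v; rewrite msuppX inE => /eqP->. Qed.

Lemma supported_sub P Q p :
  (forall u, P u -> Q u) -> supported P p -> supported Q p.
Proof. by move=> sPQ Pp u /Pp; apply: sPQ. Qed.

Lemma supportedM P1 P2 Q p q :
  (forall u v, P1 u -> P2 v -> Q (u + v)%MM) ->
  supported P1 p -> supported P2 q -> supported Q (p * q).
Proof.
move=> PQ Pp Pq u /msuppM_le /allpairsP[[v w] [/Pp Pv /Pq Pw ->]].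
exact: PQ.
Qed.

Lemma supported1 P : P 0%MM -> supported P 1.
Proof. by move=> P0; rewrite -mpolyX0; apply: supportedX. Qed.

(** A family of additive degrees is followed at once, such as the degrees of
    all the rows of a monomial. *)
Lemma supported_prod A (D : A -> 'X_{1..N} -> nat) I (s : seq I)
    (e : I -> A -> nat) (F : I -> {mpoly k[N]}) :
    (forall a, D a 0%MM = 0%N) ->
    (forall a u v, D a (u + v)%MM = (D a u + D a v)%N) ->
    (forall i, supported (fun u => forall a, D a u = e i a) (F i)) ->
  supported (fun u => forall a, D a u = (\sum_(i <- s) e i a)%N)
    (\prod_(i <- s) F i).
Proof.
move=> D0 DD degF; elim: s => [|i s IHs].
  by rewrite big_nil; apply: supported1 => a; rewrite big_nil.
rewrite big_cons; apply: (supportedM _ (degF i) IHs) => u v degu degv a.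
by rewrite big_cons DD degu degv.
Qed.

Lemma supported_lt0 (om : 'X_{1..N} -> nat) p :
  supported (fun u => om u < 0)%N p -> p = 0.
Proof.
move=> lt0; apply: msuppnil0; case Ds: (msupp p) => [//|u s].
by have := lt0 u; rewrite Ds mem_head => /(_ isT).
Qed.

Lemma dhomog_supported e p : p \is e.-homog <-> supported (fun u => mdeg u = e) p.
Proof. by split=> [/dhomogP|?]; last apply/dhomogP. Qed.

End Supported.

(** * Leading terms for an additive weight *)

Section Leading.
Variables (k : comNzRingType) (N : nat) (om : 'X_{1..N} -> nat).
Hypothesis omD : forall u v, om (u + v)%MM = (om u + om v)%N.
Implicit Types (p q : {mpoly k[N]}) (u v : 'X_{1..N}).

(** Distinct monomials may have the same weight, so that u has to be the only
    monomial of maximal weight in p. *)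
Definition leads u p := supported (fun v => om v < om u)%N (p - 'X_[u]).

Lemma leadsM u v p q : leads u p -> leads v q -> leads (u + v)%MM (p * q).
Proof.
move=> lp lq; rewrite /leads mpolyXD.
have -> : p * q - 'X_[u] * 'X_[v] =
  (p - 'X_[u]) * (q - 'X_[v]) + (p - 'X_[u]) * 'X_[v] + 'X_[u] * (q - 'X_[v]).
  by ring.
have sm := supported_submodule k (fun w => om w < om (u + v)%MM)%N.
apply: (submoduleD sm); first apply: (submoduleD sm).
- by apply: (supportedM _ lp lq) => w w' ? ?; rewrite !omD; lia.
- apply: (supportedM _ lp (supportedX (erefl v))) => w w' ? <-.
  by rewrite !omD ltn_add2r.
- apply: (supportedM _ (supportedX (erefl u)) lq) => w w' <- ?.
  by rewrite !omD ltn_add2l.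
Qed.

Lemma leadsX u : leads u 'X_[u].
Proof. by rewrite /leads subrr => v; rewrite msupp0. Qed.

Lemma leads_prod I (s : seq I) (u : I -> 'X_{1..N}) (p : I -> {mpoly k[N]}) :
  (forall i, leads (u i) (p i)) ->
  leads (\sum_(i <- s) u i)%MM (\prod_(i <- s) p i).
Proof.
move=> up; elim/big_rec2: _ => [|i v q _]; last exact: leadsM.
by rewrite -mpolyX0; apply: leadsX.
Qed.

Lemma leads_coef u v p : leads u p -> (om u <= om v)%N -> p@_v = (u == v)%:R.
Proof.
move=> lu uv; rewrite -[p](subrK 'X_[u]) mcoeffD mcoeffX.
rewrite memN_msupp_eq0 ?add0r //; apply/negP => /lu; lia.
Qed.

(** Straightening: subtracting the multiples of generators that are led by the
    monomials of maximal weight of an element of C lowers its maximal weight. *)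
Lemma straighten (C G : {mpoly k[N]} -> Prop) (std : 'X_{1..N} -> Prop) :
    submodule C -> (forall p, G p -> C p) ->
    (forall p u, C p -> u \in msupp p ->
       (forall v, v \in msupp p -> om v <= om u)%N -> std u) ->
    (forall u, std u -> exists2 g, G g & leads u g) ->
  forall p, C p -> span G p.
Proof.
move=> Csub sGC maxstd stdG.
suff main B p : C p -> supported (fun v => om v < B)%N p -> span G p.
  move=> p Cp; apply: (main (\max_(u <- msupp p) (om u).+1)) => // u pu.
  exact: (leq_bigmax_seq (F := fun u => (om u).+1)).
elim: B p => [|B IHB] p Cp ltB.
  by rewrite (supported_lt0 ltB); case: (span_submodule G).
have [g [Gg Cg ltg]]: exists g, [/\ span G g, C g &
    supported (fun v => om v < B)%N
      (\sum_(u <- msupp p | om u == B) p@_u *: 'X_[u] - g)].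
  have: {subset msupp p <= msupp p} by [].
  elim: {1 3}(msupp p) => [|u s IHs] sp.
    exists 0; rewrite big_nil subr0; split; [|exact: Csub.1|].
      exact: (span_submodule G).1.
    exact: (supported_submodule k _).1.
  have [|g [Gg Cg ltg]] := IHs; first by move=> v sv; apply: sp; rewrite inE sv orbT.
  rewrite big_cons; case: eqP => [omu|_]; last by exists g.
  have pu : u \in msupp p by apply: sp; rewrite mem_head.
  have [h Gh uh]: exists2 h, G h & leads u h.
    by apply/stdG/(maxstd p) => // v /ltB; rewrite omu ltnS.
  exists (p@_u *: h + g); split.
  - by apply: (span_submodule G).2 => //; apply: span_gen.
  - by apply: Csub.2 => //; apply: sGC.
  - rewrite opprD addrACA -scalerBr -[_ - h]opprB scalerN -scaleNr.
    by apply: (supported_submodule k _).2 ltg; rewrite -omu.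
have sub := @submoduleB _ _ _ _ _ Csub Cp Cg.
rewrite -[p](subrK g); apply: submoduleD => //; first exact: span_submodule.
apply: IHB => //; rewrite [p in p - g]mpolyE (bigID (fun u => om u == B)) /= addrAC.
apply: submoduleD (supported_submodule k _) ltg _.
rewrite big_seq_cond; apply: submodule_sum (supported_submodule k _) _ => u.
case/andP=> /ltB lu neu; apply: submoduleZ (supported_submodule k _) _.
by apply: supportedX; lia.
Qed.

(** At a monomial u i of maximal weight with c i <> 0, all the other summands
    have coefficient 0, even those with a leading monomial of the same weight. *)
Lemma leads_free (I : finType) (u : I -> 'X_{1..N}) (p : I -> {mpoly k[N]})
    (c : I -> k) :
    injective u -> (forall i, leads (u i) (p i)) ->
  (forall w, \sum_i c i * (p i)@_w = 0) -> forall i, c i = 0.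
Proof.
move=> inju up sum0 i0; apply/eqP/idPn => ci0.
have [i ci maxi] := @arg_maxnP _ i0 (fun i => c i != 0) (fun i => om (u i)) ci0.
have := sum0 (u i); rewrite (bigD1 i) //= (leads_coef (up i)) // eqxx mulr1.
rewrite big1 ?addr0 => [/eqP|j neji]; first by rewrite (negPf ci).
have [->|/maxi leji] := eqVneq (c j) 0; first by rewrite mul0r.
by rewrite (leads_coef (up j)) // (inj_eq inju) (negPf neji) mulr0.
Qed.

End Leading.

(** * Monomials of tensor powers *)

HB.instance Definition _ (k : comNzRingType) n m (a : 'I_m) :=
  GRing.LRMorphism.copy (@place k n m a) (comp_mpoly [tuple var a j | j < n]).

HB.instance Definition _ (k : comNzRingType) n m N (P : 'M[{mpoly k[N]}]_(m, n)) :=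
  GRing.LRMorphism.copy (subst P)
    (comp_mpoly [tuple mxvec P 0 i | i < m * n]).

Section Rows.
Variable n : nat.
Implicit Types (m l : nat) (v : 'X_{1..n}).

(** A monomial of the m-th tensor power is a tensor of m monomials, its rows. *)
Definition rowm m (u : 'X_{1..m * n}) (a : 'I_m) : 'X_{1..n} :=
  [multinom u (mxvec_index a j) | j < n].

Definition ofrows m (w : 'I_m -> 'X_{1..n}) : 'X_{1..m * n} :=
  [multinom (mxvec (\matrix_(a < m, j < n) w a j)) ord0 i | i < m * n].

Lemma rowm_ofrows m (w : 'I_m -> 'X_{1..n}) a : rowm (ofrows w) a = w a.
Proof. by apply/mnmP => j; rewrite !mnmE mxvecE mxE. Qed.

Lemma rowm_inj m (u v : 'X_{1..m * n}) : (forall a, rowm u a = rowm v a) -> u = v.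
Proof.
move=> uv; apply/mnmP => i; case/mxvec_indexP: i => a j.
by have /mnmP/(_ j) := uv a; rewrite !mnmE.
Qed.

Lemma rowmD m (u v : 'X_{1..m * n}) a : rowm (u + v)%MM a = (rowm u a + rowm v a)%MM.
Proof. by apply/mnmP => j; rewrite !mnmE. Qed.

Lemma rowm0 m a : rowm (0%MM : 'X_{1..m * n}) a = 0%MM.
Proof. by apply/mnmP => j; rewrite !mnmE. Qed.

Lemma rowm_sum m I (s : seq I) (C : pred I) (u : I -> 'X_{1..m * n}) a :
  rowm (\sum_(i <- s | C i) u i)%MM a = (\sum_(i <- s | C i) rowm (u i) a)%MM.
Proof. by elim/big_rec2: _ => [|i v w _ <-]; rewrite ?rowm0 ?rowmD. Qed.

Lemma rowmU m (a b : 'I_m) (j : 'I_n) :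
  rowm U_(mxvec_index a j)%MM b = (if a == b then U_(j) else 0)%MM.
Proof.
have [f fK _] := curry_mxvec_bij m n.
apply/mnmP => j'; rewrite mnmE mnm1E.
have -> : (mxvec_index a j == mxvec_index b j') = ((a, j) == (b, j')).
  apply/eqP/eqP => [eqi|[-> ->]] //.
  by rewrite -(fK (a, j) isT) -(fK (b, j') isT) /= eqi.
by rewrite xpair_eqE; case: eqP; rewrite ?mnm1E ?mnm0E.
Qed.

Lemma mdeg_rows m (u : 'X_{1..m * n}) : mdeg u = (\sum_a mdeg (rowm u a))%N.
Proof.
rewrite mdegE (reindex (fun x : 'I_m * 'I_n => mxvec_index x.1 x.2)) /=.
  rewrite -(pair_bigA _ (fun a j => u (mxvec_index a j))) /=.
  by apply: eq_bigr => a _; rewrite mdegE; apply: eq_bigr => j _; rewrite mnmE.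
have [f fK Kf] := curry_mxvec_bij m n.
by exists f => [[a j] _|i _]; [rewrite -[RHS]fK | rewrite -[RHS]Kf; case: (f i)].
Qed.

(** The monomial into which relabel f turns u, see relabelX. *)
Definition push m l (f : 'I_m -> 'I_l) (u : 'X_{1..m * n}) : 'X_{1..l * n} :=
  ofrows (fun b => \sum_(a | f a == b) rowm u a)%MM.

Lemma rowm_push m l (f : 'I_m -> 'I_l) u b :
  rowm (push f u) b = (\sum_(a | f a == b) rowm u a)%MM.
Proof. exact: rowm_ofrows. Qed.

Lemma mdeg_push m l (f : 'I_m -> 'I_l) u : mdeg (push f u) = mdeg u.
Proof.
rewrite [LHS]mdeg_rows [RHS]mdeg_rows (partition_big f xpredT) //=.
by apply: eq_bigr => b _; rewrite rowm_push mdeg_sum.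
Qed.

Definition ucons m v (w : 'X_{1..m * n}) : 'X_{1..m.+1 * n} :=
  ofrows (fun a => oapp (rowm w) v (unlift ord0 a)).

Definition utail m (u : 'X_{1..m.+1 * n}) : 'X_{1..m * n} :=
  ofrows (fun a => rowm u (lift ord0 a)).

Lemma rowm_utail m (u : 'X_{1..m.+1 * n}) a :
  rowm (utail u) a = rowm u (lift ord0 a).
Proof. exact: rowm_ofrows. Qed.

Lemma rowm_ucons0 m v (w : 'X_{1..m * n}) : rowm (ucons v w) ord0 = v.
Proof. by rewrite rowm_ofrows unlift_none. Qed.

Lemma rowm_ucons m v (w : 'X_{1..m * n}) a :
  rowm (ucons v w) (lift ord0 a) = rowm w a.
Proof. by rewrite rowm_ofrows liftK. Qed.

Lemma ucons_utail m (u : 'X_{1..m.+1 * n}) : ucons (rowm u ord0) (utail u) = u.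
Proof.
by apply: rowm_inj => a; case: (unliftP ord0 a) => [b|] ->;
  rewrite ?rowm_ucons0 // rowm_ucons rowm_utail.
Qed.

Lemma utail_ucons m v (w : 'X_{1..m * n}) : utail (ucons v w) = w.
Proof. by apply: rowm_inj => a; rewrite rowm_utail rowm_ucons. Qed.

Definition rowwt v := (\sum_(j < n) v j * j)%N.

Lemma rowwtD v w : rowwt (v + w)%MM = (rowwt v + rowwt w)%N.
Proof. by rewrite -big_split; apply: eq_bigr => j _; rewrite mnmDE mulnDl. Qed.

(** Exchanging a variable for a smaller one of a higher row lowers the weight.
    Thus a strict column is led by its diagonal term, while two rows without a
    descent are the lightest way of distributing their variables. *)
Definition wt m (u : 'X_{1..m * n}) := (\sum_(a < m) (m - a) * rowwt (rowm u a))%N.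

Lemma wtD m (u v : 'X_{1..m * n}) : wt (u + v)%MM = (wt u + wt v)%N.
Proof. by rewrite -big_split; apply: eq_bigr => a _; rewrite rowmD rowwtD mulnDr. Qed.

Lemma wt_ucons m v (w : 'X_{1..m * n}) : wt (ucons v w) = (m.+1 * rowwt v + wt w)%N.
Proof.
rewrite /wt big_ord_recl rowm_ucons0; congr (_ + _)%N.
by apply: eq_bigr => a _; rewrite rowm_ucons.
Qed.

End Rows.

Section TensorMonomials.
Variables (k : comNzRingType) (n : nat).
Implicit Types (m l : nat) (s p : sym k n).

(** Multiplies together the tensor factors with the same label: the
    differential and shift are of this form, see ribbon_diff_fuse and shiftE. *)
Definition relabel m l (f : 'I_m -> 'I_l) : tpow k n m -> tpow k n l :=
  subst (\matrix_(a < m, j < n) var (f a) j).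

HB.instance Definition _ m l (f : 'I_m -> 'I_l) :=
  GRing.LRMorphism.copy (relabel f) (subst (\matrix_(a < m, j < n) var (f a) j)).

Lemma mpolyX_rows m (u : 'X_{1..m * n}) :
  'X_[u] = tens (fun a => 'X_[rowm u a]) :> tpow k n m.
Proof. exact: tens_mon. Qed.

Lemma tens_rows m (w : 'I_m -> 'X_{1..n}) :
  tens (fun a => 'X_[w a]) = 'X_[ofrows w] :> tpow k n m.
Proof. exact: mon_tens. Qed.

Lemma relabel_place m l (f : 'I_m -> 'I_l) a s : relabel f (place a s) = place (f a) s.
Proof.
rewrite /relabel subst_place; congr (_ \mPo _).
by apply: eq_from_tnth => j; rewrite !tnth_mktuple mxE.
Qed.

Lemma relabelX m l (f : 'I_m -> 'I_l) u : relabel f 'X_[u] = 'X_[push f u].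
Proof.
rewrite mpolyX_rows -tens_rows /tens rmorph_prod /= (partition_big f xpredT) //=.
apply: eq_bigr => b _; rewrite -mprodXE rmorph_prod /=.
by apply: eq_bigr => a /eqP fa; rewrite relabel_place fa.
Qed.

Lemma relabel_coef m l (f : 'I_m -> 'I_l) t v :
  (relabel f t)@_v = \sum_(u <- msupp t | push f u == v) t@_u.
Proof.
rewrite {1}[t]mpolyE [relabel _ _]raddf_sum raddf_sum [RHS]big_mkcond /=.
apply: eq_bigr => u _; rewrite linearZ mcoeffZ /= relabelX mcoeffX.
by case: eqP; rewrite ?mulr1 ?mulr0.
Qed.

Lemma subst_subst m l N (P : 'M[{mpoly k[N]}]_(m, n)) (Q : 'M[tpow k n m]_(l, n)) t :
  subst P (subst Q t) = subst (\matrix_(a, j) subst P (Q a j)) t.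
Proof.
rewrite [t]mpolyE [subst Q _]raddf_sum ![subst _ (\sum_(_ <- _) _)]raddf_sum /=.
apply: eq_bigr => u _.
rewrite !linearZ; congr (_ *: _); rewrite /= /subst !comp_mpolyX rmorph_prod.
apply: eq_bigr => i _; rewrite rmorphXn !tnth_mktuple.
by case/mxvec_indexP: i => a j; rewrite !mxvecE mxE.
Qed.

Lemma eq_relabel m l (f g : 'I_m -> 'I_l) : f =1 g -> relabel f =1 relabel g.
Proof.
by move=> fg t; congr (subst _ t); apply/matrixP => a j; rewrite !mxE fg.
Qed.

Lemma relabel_comp m l q (f : 'I_l -> 'I_q) (g : 'I_m -> 'I_l) t :
  relabel f (relabel g t) = relabel (f \o g) t.
Proof.
rewrite /relabel subst_subst; congr (subst _ t).
by apply/matrixP => a j; rewrite !mxE subst_var mxE.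
Qed.

Lemma gl_act_relabel g m l (f : 'I_m -> 'I_l) (t : tpow k n m) :
  gl_act g (relabel f t) = relabel f (gl_act g t).
Proof.
rewrite /relabel /gl_act !subst_subst; congr (subst _ t).
apply/matrixP => a j; rewrite !mxE subst_var mxE raddf_sum.
by apply: eq_bigr => i _ /=; rewrite linearZ /= subst_var mxE.
Qed.

Lemma supported_relabel m l (f : 'I_m -> 'I_l) (P : _ -> Prop) (Q : _ -> Prop)
    (t : tpow k n m) :
  (forall u, P u -> Q (push f u)) -> supported P t -> supported Q (relabel f t).
Proof.
move=> PQ Pt; rewrite [t]mpolyE [relabel f _]raddf_sum big_seq.
apply: submodule_sum (supported_submodule k _) _ => u /Pt Pu.
rewrite /= linearZ; apply: submoduleZ (supported_submodule k _) _.
by rewrite /= relabelX; apply: supportedX; apply: PQ.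
Qed.

Lemma shiftE m (t : tpow k n m) : shift t = relabel (lift ord0) t.
Proof. by []. Qed.

Lemma tconsX m v (w : 'X_{1..m * n}) :
  tcons 'X_[v] 'X_[w] = 'X_[ucons v w] :> tpow k n m.+1.
Proof.
rewrite -tens_rows /tens big_ord_recl unlift_none /= /tcons; congr (_ * _).
rewrite mpolyX_rows shiftE rmorph_prod; apply: eq_bigr => a _.
by rewrite liftK /= relabel_place.
Qed.

Lemma tconsDl m s s' (t : tpow k n m) : tcons (s + s') t = tcons s t + tcons s' t.
Proof. by rewrite /tcons raddfD mulrDl. Qed.

Lemma tconsDr m s (t t' : tpow k n m) : tcons s (t + t') = tcons s t + tcons s t'.
Proof. by rewrite /tcons !shiftE raddfD mulrDr. Qed.

Lemma tconsZl m c s (t : tpow k n m) : tcons (c *: s) t = c *: tcons s t.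
Proof. by rewrite /tcons linearZ scalerAl. Qed.

Lemma tconsZr m c s (t : tpow k n m) : tcons s (c *: t) = c *: tcons s t.
Proof. by rewrite /tcons shiftE linearZ scalerAr. Qed.

Lemma lscale_tcons m s p (t : tpow k n m) : lscale s (tcons p t) = tcons (s * p) t.
Proof. by rewrite /lscale /tcons rmorphM mulrA. Qed.

(** The coefficients are those of the tensor product of free modules. *)
Lemma tcons_coef m s (t : tpow k n m) u :
  (tcons s t)@_u = s@_(rowm u ord0) * t@_(utail u).
Proof.
elim/mpolyind: s => [|c v s _ _ IHs].
  by rewrite /tcons rmorph0 mul0r !mcoeff0 mul0r.
rewrite tconsDl !mcoeffD IHs mulrDl; congr (_ + _) => {s IHs}.
rewrite tconsZl !mcoeffZ -mulrA; congr (_ * _).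
elim/mpolyind: t => [|c' w t _ _ IHt].
  by rewrite /tcons shiftE rmorph0 mulr0 !mcoeff0 mulr0.
rewrite tconsDr !mcoeffD mulrDr IHt; congr (_ + _); rewrite tconsZr !mcoeffZ tconsX.
rewrite mulrCA !mcoeffX -natrM mulnb; congr (_ * (nat_of_bool _)%:R).
apply/eqP/andP => [<-|[/eqP-> /eqP->]]; last exact: ucons_utail.
by rewrite rowm_ucons0 utail_ucons.
Qed.

Lemma supported_tcons m (P Q W : _ -> Prop) s (t : tpow k n m) :
  (forall v w, P v -> Q w -> W (ucons v w)) ->
  supported P s -> supported Q t -> supported W (tcons s t).
Proof.
move=> PQ Ps Qt u; rewrite mcoeff_msupp tcons_coef => nz.
rewrite -[u]ucons_utail; apply: PQ; [apply: Ps | apply: Qt];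
by rewrite mcoeff_msupp; apply: contraNneq nz => ->; rewrite ?mul0r ?mulr0.
Qed.

Lemma leads_tcons m v w (t : tpow k n m) :
  leads (@wt n m) w t -> leads (@wt n m.+1) (ucons v w) (tcons 'X_[v] t).
Proof.
move=> lt; rewrite /leads -tconsX.
have -> : tcons 'X_[v] t - tcons 'X_[v] 'X_[w] = tcons 'X_[v] (t - 'X_[w]).
  by rewrite /tcons !shiftE raddfB mulrBr.
apply: (supported_tcons _ (supportedX (erefl v)) lt) => _ w' <- ?.
by rewrite !wt_ucons ltn_add2l.
Qed.

Lemma placeX m (a : 'I_m) v :
  place a 'X_[v] = 'X_[ofrows (fun b => if b == a then v else 0%MM)] :> tpow k n m.
Proof.
rewrite -tens_rows /tens (bigD1 a) //= eqxx big1 ?mulr1 // => b /negPf->.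
by rewrite mpolyX0 rmorph1.
Qed.

Lemma supported_place m (a : 'I_m) (P Q : _ -> Prop) s :
  (forall v, P v -> Q (ofrows (fun b => if b == a then v else 0%MM))) ->
  supported P s -> supported Q (place a s : tpow k n m).
Proof.
move=> PQ Ps; rewrite [s]mpolyE [place a _]raddf_sum big_seq.
apply: submodule_sum (supported_submodule k _) _ => u /Ps Pu.
rewrite /= linearZ; apply: submoduleZ (supported_submodule k _) _.
by rewrite /= placeX; apply: supportedX; apply: PQ.
Qed.

End TensorMonomials.

(** * Fusing adjacent rows *)

Section Fuse.
Variable n : nat.

(** The lower one of the two rows a and lift ord0 a that fuse a identifies. *)
Definition below m (a : 'I_m) : 'I_m.+1 := widen_ord (leqnSn m) a.

Definition fuse m (a : 'I_m) (b : 'I_m.+1) : 'I_m :=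
  odflt a (unlift (lift ord0 a) b).

Lemma fuseE m (a : 'I_m) b : fuse a b = (b - (a < b))%N :> nat.
Proof.
rewrite /fuse; case: unliftP => [c|] ->; rewrite /= !/bump /=; last by lia.
case: leqP; lia.
Qed.

Lemma fuse_comp m (a b : 'I_m) : (a <= b)%N ->
  fuse b \o fuse (below a) =1 fuse a \o fuse (lift ord0 b).
Proof. by move=> ab c; apply: val_inj; rewrite /= !fuseE /= /bump /=; lia. Qed.

Lemma fuse_below m (a : 'I_m) : fuse a (below a) = a.
Proof. by apply: val_inj; rewrite /= fuseE /= ltnn subn0. Qed.

Lemma fuse_lift m (a b : 'I_m) : (a <= b)%N -> fuse a (lift ord0 b) = b.
Proof. by move=> ab; apply: val_inj; rewrite /= fuseE /= /bump /=; lia. Qed.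

Lemma fuse_inj m (a : 'I_m) b c :
  b != below a -> b != lift ord0 a -> fuse a c = fuse a b -> c = b.
Proof.
rewrite -!val_eqE /= /bump /= => ba ba' /(congr1 val); rewrite /= !fuseE => ?.
by apply: val_inj => /=; lia.
Qed.

Lemma lift_neq_below m (a : 'I_m) : lift ord0 a != below a.
Proof. by rewrite -val_eqE /= /bump; lia. Qed.

Lemma rowm_fuse m (a : 'I_m) (u : 'X_{1..m.+1 * n}) :
  rowm (push (fuse a) u) a = (rowm u (below a) + rowm u (lift ord0 a))%MM.
Proof.
rewrite rowm_push (bigD1 (below a)) /= ?fuse_below //; congr (_ + _)%MM.
rewrite (bigD1 (lift ord0 a)) /= ?fuse_lift ?eqxx ?lift_neq_below //.
rewrite big1 ?addm0 // => b /andP[/andP[/eqP fb ba] ba'].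
have eqb := fuse_inj ba ba' (etrans (fuse_below a) (esym fb)).
by rewrite eqb eqxx in ba.
Qed.

Lemma rowm_fuse_neq m (a : 'I_m) b (u : 'X_{1..m.+1 * n}) :
  b != below a -> b != lift ord0 a -> rowm (push (fuse a) u) (fuse a b) = rowm u b.
Proof.
move=> ba ba'; rewrite rowm_push (big_pred1 b) // => c /=.
by apply/eqP/eqP => [|->] //; apply: fuse_inj.
Qed.

Lemma rowm_fuse_lt m (a b : 'I_m) (u : 'X_{1..m.+1 * n}) :
  (a < b)%N -> rowm (push (fuse a) u) b = rowm u (lift ord0 b).
Proof.
move=> ab; rewrite -{1}(fuse_lift (ltnW ab)) rowm_fuse_neq //.
  by rewrite -val_eqE /= /bump; lia.
by rewrite (inj_eq lift_inj) neq_ltn ab orbT.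
Qed.

(** When the entries of the rows are put in increasing order, this is the
    condition on the column shared by the two rows: the last entry of row a
    exceeds the first entry of the row above it. *)
Definition descent m (a : 'I_m) (u : 'X_{1..m.+1 * n}) : bool :=
  [exists j : 'I_n, exists j' : 'I_n,
    [&& j' < j, 0 < rowm u (below a) j & 0 < rowm u (lift ord0 a) j']%N].

Lemma descentP m (a : 'I_m) (u : 'X_{1..m.+1 * n}) :
  reflect (exists j j' : 'I_n, [/\ j' < j, 0 < rowm u (below a) j
                                 & 0 < rowm u (lift ord0 a) j']%N)
          (descent a u).
Proof.
apply: (iffP idP) => [/existsP[j /existsP[j' /and3P[lt_j uj uj']]]|].
  by exists j, j'.
case=> j [j' [lt_j uj uj']].
by apply/existsP; exists j; apply/existsP; exists j'; rewrite lt_j uj uj'.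
Qed.

(** Among the ways of distributing a multiset of variables over two rows of
    fixed sizes, putting all the small ones in the first row is the unique one
    of minimal weight. *)
Lemma rowwt_min (u0 u1 v0 v1 : 'X_{1..n}) :
    (forall j j' : 'I_n, 0 < u0 j -> 0 < u1 j' -> j <= j')%N ->
    (v0 + v1 = u0 + u1)%MM -> mdeg v0 = mdeg u0 ->
  (rowwt v0 <= rowwt u0)%N -> v0 = u0.
Proof.
move=> le01 eq_uv eq_deg le_wt.
(* All copies of the variables below p lie in u0 and all copies of those above p
   in u1, so that every deviation of v0 from u0 adds weight, measured from p. *)
pose p := (\max_(j < n | 0 < u0 j) j)%N.
have le0p (j : 'I_n) : (0 < u0 j -> j <= p)%N by exact: leq_bigmax_cond.
have lep1 (j : 'I_n) : (0 < u1 j -> p <= j)%N.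
  by move=> u1j; apply/bigmax_leqP => i /le01; apply.
have uv j : (v0 j + v1 j = u0 j + u1 j)%N by rewrite -!mnmDE eq_uv.
have leif j : true -> (u0 j * j + v0 j * p <= v0 j * j + u0 j * p
    ?= iff ((j == p :> nat) || (v0 j == u0 j)))%N.
  move=> _; apply/leqifP; have := uv j.
  have [jp|jp|-> _] := ltngtP j p; last by rewrite /= addnC.
    have -> : u1 j = 0%N by case: (posnP (u1 j)) => // /lep1; rewrite leqNgt jp.
    case: (v0 j =P u0 j) => [-> _|neq eqj] /=; first by rewrite eqxx.
    by move: (nat_of_ord j) jp => i jp; nia.
  have -> : u0 j = 0%N by case: (posnP (u0 j)) => // /le0p; rewrite leqNgt jp.
  case: (v0 j =P 0%N) => [-> _|neq eqj] /=; first by rewrite eqxx.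
    by move: (nat_of_ord j) jp => i jp; nia.
have := leqif_sum leif; rewrite !big_split /= -!big_distrl /= -!mdegE eq_deg.
rewrite -!/(rowwt _) => -[_]; have -> : rowwt v0 = rowwt u0.
  have [+ _] := leqif_sum leif; rewrite !big_split /= -!big_distrl /= -!mdegE eq_deg.
  rewrite -!/(rowwt _); lia.
rewrite eqxx => /esym/forallP eqP'.
have eq_off (j : 'I_n) : j != p :> nat -> v0 j = u0 j.
  by move=> /negPf njp; have := eqP' j; rewrite /= njp => /eqP.
apply/mnmP => j; have [jp|/eq_off//] := eqVneq (nat_of_ord j) p.
move: eq_deg; rewrite !mdegE (bigD1 j) //= [RHS](bigD1 j) //= => /eqP.
rewrite (eq_bigr u0) ?eqn_add2r => [/eqP//|i nij]; apply: eq_off.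
by rewrite -jp.
Qed.

(** If row a and the row above it did not form a descent, u would be of minimal
    weight among the monomials fused to the same one, hence the only one of
    these in t, so that its coefficient would survive in the fusion of t. *)
Lemma descent_max (k : comNzRingType) m (a : 'I_m) (t : tpow k n m.+1) u :
    relabel (fuse a) t = 0 -> u \in msupp t ->
    (forall v, v \in msupp t -> wt v <= wt u)%N ->
    (forall v, v \in msupp t ->
       mdeg (rowm v (lift ord0 a)) = mdeg (rowm u (lift ord0 a))) ->
  descent a u.
Proof.
move=> at0 tu maxu degt; case: (boolP (descent a u)) => // ndesc; exfalso.
have le_u (j j' : 'I_n) :
    (0 < rowm u (below a) j -> 0 < rowm u (lift ord0 a) j' -> j <= j')%N.
  move=> uj uj'; rewrite leqNgt; apply: (contra _ ndesc) => lt_j.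
  by apply/descentP; exists j, j'.
suff uniq v : v \in msupp t -> push (fuse a) v = push (fuse a) u -> v = u.
  have := tu; rewrite mcoeff_msupp => /negP; apply; apply/eqP.
  have := relabel_coef (fuse a) t (push (fuse a) u); rewrite at0 mcoeff0.
  rewrite big_mkcond (bigD1_seq u) ?msupp_uniq //= eqxx big1_seq ?addr0 //.
  move=> v /andP[neq tv]; case: eqP => // /(uniq v tv) eq_vu.
  by rewrite eq_vu eqxx in neq.
move=> tv eq_push.
have eq_other b : b != below a -> b != lift ord0 a -> rowm v b = rowm u b.
  by move=> ba ba'; rewrite -(rowm_fuse_neq _ ba ba') eq_push rowm_fuse_neq.
have eq_sum : (rowm v (below a) + rowm v (lift ord0 a) =
               rowm u (below a) + rowm u (lift ord0 a))%MM.
  by rewrite -!rowm_fuse eq_push.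
have eq_below : rowm v (below a) = rowm u (below a).
  apply: (rowwt_min le_u eq_sum).
    have := congr1 (@mdeg n) eq_sum; rewrite !mdegD degt // => /eqP.
    by rewrite eqn_add2r => /eqP.
  have := congr1 (@rowwt n) eq_sum; rewrite !rowwtD.
  have := maxu _ tv; rewrite /wt.
  have split_rows w : (\sum_(b < m.+1) (m.+1 - b) * rowwt (rowm w b) =
      (m.+1 - a) * rowwt (rowm w (below a)) +
      ((m - a) * rowwt (rowm w (lift ord0 a)) +
       \sum_(b < m.+1 | (b != below a) && (b != lift ord0 a))
          (m.+1 - b) * rowwt (rowm w b)))%N.
    by rewrite (bigD1 (below a)) //= (bigD1 (lift ord0 a)) ?lift_neq_below.
  rewrite !split_rows.
  rewrite (eq_bigr (fun b : 'I_m.+1 => (m.+1 - b) * rowwt (rowm u b)))%N; last first.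
    by move=> b /andP[? ?]; rewrite eq_other.
  set X := (\sum_(_ < _ | _) _)%N.
  have lt_am : (a < m)%N := ltn_ord a.
  have -> : (m.+1 - a = (m - a).+1)%N by apply: subSn; apply: ltnW.
  nia.
apply: rowm_inj => b; have [->|ba] := eqVneq b (below a); first exact: eq_below.
have [->|ba'] := eqVneq b (lift ord0 a); last exact: eq_other.
by move: eq_sum; rewrite eq_below => /addmI.
Qed.

End Fuse.

(** * Columns *)

Lemma perm_inversion p (w : 'S_p) : w != 1%g ->
  exists s t : 'I_p, (s < t)%N /\ (w t < w s)%N.
Proof.
move=> w1; have [i0 wi0]: exists i, w i != i.
  apply/existsP; apply: contraR w1 => /existsPn fixw; apply/eqP/permP => i.
  by rewrite perm1; apply/eqP; rewrite -[_ == _]negbK fixw.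
have [s ws mins] := @arg_minnP _ i0 (fun i => w i != i) (@nat_of_ord p) wi0.
exists s, ((w^-1)%g s); rewrite permKV; split.
  rewrite ltn_neqAle mins ?andbT ?permKV.
    by apply: contraNneq ws => /val_inj{1}->; rewrite permKV.
  by apply: contraNneq ws => {1}->; rewrite permKV.
rewrite ltn_neqAle mins ?andbT ?(inj_eq perm_inj) //.
by apply: contraNneq ws => /val_inj <-.
Qed.

(** A permutation maximizing the sum has no inversion, as exchanging the two
    values of an inversion increases the sum. *)
Lemma rearrangement p (c x : 'I_p -> nat) (w : 'S_p) :
    (forall s t : 'I_p, s < t -> c s < c t)%N ->
    (forall s t : 'I_p, s < t -> x s < x t)%N -> w != 1%g ->
  (\sum_t c t * x (w t) < \sum_t c t * x t)%N.
Proof.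
move=> cmono xmono.
pose F (w : 'S_p) := (\sum_t c t * x (w t))%N.
have F1 : (\sum_t c t * x t)%N = F 1%g by apply: eq_bigr => t _; rewrite perm1.
rewrite F1 -/(F w) {F1}.
have improve w' : w' != 1%g -> exists w'' : 'S_p, (F w' < F w'')%N.
  case/perm_inversion=> s [t [st wts]]; exists (tperm s t * w')%g.
  have nts : t != s by rewrite -val_eqE /=; lia.
  have split_F v : F v = (c s * x (v s) + (c t * x (v t) +
      \sum_(i | (i != s) && (i != t)) c i * x (v i)))%N.
    by rewrite /F (bigD1 s) //= (bigD1 t).
  rewrite !split_F !permM tpermL tpermR; set X := (\sum_(_ | _) _)%N.
  rewrite (eq_bigr (fun i => c i * x (w' i))%N) => [|i /andP[ns nt]].
    by have := cmono _ _ st; have := xmono _ _ wts; rewrite -/X; nia.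
  by rewrite permM tpermD // eq_sym.
have [v _ maxv] := @arg_maxnP _ (1%g : 'S_p) xpredT F isT.
have v1 : v = 1%g.
  apply/eqP; apply/idPn => /improve[v' ltv]; have /= := maxv v' isT.
  by rewrite leqNgt ltv.
by move=> /improve[w' ltw]; apply: leq_trans ltw _; rewrite -v1; apply: maxv.
Qed.

Lemma enum_val_mono p (A : {set 'I_p}) (s t : 'I_#|A|) :
  (s < t)%N -> (enum_val s < enum_val t)%N.
Proof.
move=> st; have i0 : 'I_p := enum_val s.
have tr : transitive (fun i j : 'I_p => i < j)%N by move=> i j l; apply: ltn_trans.
have srt : sorted (fun i j : 'I_p => i < j)%N (enum A).
  rewrite /enum_mem; apply: sorted_filter => //; rewrite -enumT.
  by have := iota_ltn_sorted 0 p; rewrite -val_enum_ord sorted_map.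
rewrite !(enum_val_nth i0).
by apply: (sorted_ltn_nth tr i0 srt) => //; rewrite inE -cardE.
Qed.

Lemma big_mem_pred1 (T : Type) (idx : T) (op : Monoid.law idx) (I : finType)
    (A : {pred I}) (x : I) (F : I -> T) :
  \big[op/idx]_(i in A | i == x) F i = if x \in A then F x else idx.
Proof.
by case: ifP => Ax; [rewrite (big_pred1 x) | rewrite big_pred0] => // i /=;
  case: eqP => [->|]; rewrite ?Ax ?andbF.
Qed.

Section Columns.
Variables (k : comNzRingType) (n : nat).

Lemma linear_form_delta (j : 'I_n) :
  linear_form (\row_i (i == j)%:R : 'rV[k]_n) = 'X_j.
Proof.
rewrite /linear_form (bigD1 j) //= mxE eqxx scale1r big1 ?addr0 // => i /negPf ij.
by rewrite mxE ij scale0r.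
Qed.

(** The summand of the identity is the leading one because the column is
    strictly increasing from its top to its bottom. *)
Lemma leads_det m p (rho : 'I_p -> 'I_m) (x : 'I_p -> 'I_n) :
    (forall s t : 'I_p, s < t -> rho t < rho s)%N ->
    (forall s t : 'I_p, s < t -> x s < x t)%N ->
  leads (@wt n m) (\sum_t U_(mxvec_index (rho t) (x t)))%MM
    (\det (\matrix_(t, s) var (rho t) (x s)) : tpow k n m).
Proof.
move=> rmono xmono.
pose M (w : 'S_p) := (\sum_t U_(mxvec_index (rho t) (x (w t))))%MM.
have M1 : (\sum_t U_(mxvec_index (rho t) (x t)))%MM = M 1%g.
  by apply: eq_bigr => t _; rewrite perm1.
have detE : \det (\matrix_(t, s) var (rho t) (x s)) =
    \sum_(w : 'S_p) (-1) ^+ w *: 'X_[M w] :> tpow k n m.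
  apply: eq_bigr => w _; rewrite -mprodXE scaler_sign -mulr_sign.
  by congr (_ * _); apply: eq_bigr => t _; rewrite mxE.
have wtM w : wt (M w) = (\sum_t (m - rho t) * x (w t))%N.
  rewrite /wt (eq_bigr (fun a => \sum_t if rho t == a then (m - a) * x (w t) else 0))%N.
    rewrite exchange_big; apply: eq_bigr => t _; rewrite -big_mkcond /=.
    by rewrite (big_pred1 (rho t)) // => a /=; rewrite eq_sym.
  move=> a _; rewrite rowm_sum.
  rewrite (big_morph (@rowwt n) (@rowwtD n) (_ : _ = 0%N)); last first.
    by rewrite /rowwt big1 // => j _; rewrite mnm0E.
  rewrite big_distrr; apply: eq_bigr => t _; rewrite /= rowmU; case: eqP => _.
    rewrite /rowwt (bigD1 (x (w t))) //= mnm1E eqxx big1 ?mul1n ?addn0 // => j.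
    by rewrite mnm1E eq_sym => /negPf->.
  by rewrite /rowwt big1 ?muln0 // => j _; rewrite mnm0E.
rewrite M1 /leads detE (bigD1 1%g) //= odd_perm1 scale1r addrAC subrr add0r.
apply: submodule_sum (supported_submodule k _) _ => w w1.
apply: submoduleZ (supported_submodule k _) _; apply: supportedX.
rewrite !wtM; under [ltnRHS]eq_bigr => t _ do rewrite perm1.
by apply: rearrangement => // s t /rmono; have := ltn_ord (rho s); lia.
Qed.

Lemma supported_rowdeg_prod m I (s : seq I) (g : I -> 'I_m -> nat)
    (F : I -> tpow k n m) :
    (forall i, supported (fun u => forall a, mdeg (rowm u a) = g i a) (F i)) ->
  supported (fun u => forall a, mdeg (rowm u a) = (\sum_(i <- s) g i a)%N)
    (\prod_(i <- s) F i).
Proof.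
apply: supported_prod => [a|a u v]; first by rewrite rowm0 mdeg0.
by rewrite rowmD mdegD.
Qed.

Section Diagram.
Variables (p c : nat) (D : {set 'I_p * 'I_c}).

Lemma antisym_det (j : 'I_c) (v : 'I_#|column D j| -> 'rV[k]_n) :
  antisym v = \det (\matrix_(t, s)
     (place (rev_ord (enum_val t)) (linear_form (v s)) : tpow k n p)).
Proof.
apply: eq_bigr => w _; rewrite scaler_sign -mulr_sign; congr (_ * _).
by apply: eq_bigr => t _; rewrite mxE.
Qed.

(** The determinant of a column with two entries in fused rows has two equal
    rows. *)
Lemma relabel_antisym m (f : 'I_p -> 'I_m) (j : 'I_c) (a b : 'I_p)
    (v : 'I_#|column D j| -> 'rV[k]_n) :
    a != b -> f (rev_ord a) = f (rev_ord b) -> (a, j) \in D -> (b, j) \in D ->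
  relabel f (antisym v) = 0.
Proof.
move=> ab fab aj bj; rewrite antisym_det -det_map_mx.
have ca : a \in column D j by rewrite inE.
have cb : b \in column D j by rewrite inE.
apply: (@determinant_alternate _ _ _ (enum_rank_in ca a) (enum_rank_in ca b)).
  apply: contraNneq ab => /(congr1 (@enum_val _ _)).
  by rewrite !enum_rankK_in // => ->.
by move=> s; rewrite !mxE /= !relabel_place !enum_rankK_in // fab.
Qed.

Lemma antisym_deg (j : 'I_c) (v : 'I_#|column D j| -> 'rV[k]_n) :
  supported (fun u => forall a, mdeg (rowm u a) = ((rev_ord a, j) \in D))
    (antisym v : tpow k n p).
Proof.
apply: submodule_sum (supported_submodule k _) _ => w _.
apply: submoduleZ (supported_submodule k _) _.
apply: (@supported_sub _ _ (fun u => forall a, mdeg (rowm u a) =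
    (\sum_(t < #|column D j|) (rev_ord (enum_val t) == a))%N)).
  move=> u degu a; rewrite degu -(big_enum_val (fun i => (rev_ord i == a) : nat)).
  rewrite (eq_bigr (fun i => if i == rev_ord a then 1%N else 0%N)); last first.
    by move=> i _; rewrite (can2_eq rev_ordK rev_ordK); case: eqP.
  by rewrite -big_mkcondr big_mem_pred1 inE; case: (_ \in D).
apply: supported_rowdeg_prod => t; rewrite /linear_form.
apply: (@supported_place _ _ _ _ (fun v => mdeg v = 1%N)) => [w1 deg_w1 a|].
  by rewrite rowm_ofrows eq_sym; case: eqP; rewrite ?mdeg0.
apply: submodule_sum (supported_submodule k _) _ => i _.
by apply: submoduleZ (supported_submodule k _) _; apply: supportedX; rewrite mdeg1.
Qed.

End Diagram.
End Columns.

(** * Ribbons *)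

Section Words.
Variable n : nat.

Definition word (w : 'X_{1..n}) : seq 'I_n :=
  sort (fun i j : 'I_n => i <= j)%N (flatten [seq nseq (w j) j | j <- enum 'I_n]).

Lemma sum_nseq_mnm1 e (i j : 'I_n) :
  (\sum_(l <- nseq e j) U_(l))%MM i = if j == i then e else 0%N.
Proof.
elim: e => [|e IHe] /=; first by rewrite big_nil mnm0E if_same.
by rewrite big_cons mnmDE IHe mnm1E; case: eqP.
Qed.

Lemma word_sum (w : 'X_{1..n}) : (\sum_(j <- word w) U_(j))%MM = w.
Proof.
rewrite /word (perm_big (flatten [seq nseq (w j) j | j <- enum 'I_n])) ?perm_sort //=.
rewrite big_flatten /= big_map big_enum /=; apply/mnmP => i.
rewrite mnm_sumE (eq_bigr _ (fun j _ => sum_nseq_mnm1 _ _ _)).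
by rewrite -big_mkcond big_pred1_eq.
Qed.

Lemma size_word (w : 'X_{1..n}) : size (word w) = mdeg w.
Proof.
rewrite -[in RHS](word_sum w) mdeg_sum -sum1_size.
by apply: eq_bigr => j _; rewrite mdeg1.
Qed.

Lemma mem_word (w : 'X_{1..n}) j : (0 < w j)%N -> j \in word w.
Proof.
move=> wj; rewrite mem_sort; apply/flatten_mapP; exists j; first by rewrite mem_enum.
by rewrite mem_nseq wj eqxx.
Qed.

Lemma word_bounds i0 (w : 'X_{1..n}) j : (0 < w j)%N ->
  (nth i0 (word w) 0 <= j <= nth i0 (word w) (mdeg w).-1)%N.
Proof.
move=> /mem_word jw; rewrite -size_word.
have srt : sorted (fun i j : 'I_n => i <= j)%N (word w).
  by apply: sort_sorted => i i'; apply: leq_total.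
have tr : transitive (fun i j : 'I_n => i <= j)%N by move=> ? ? ?; apply: leq_trans.
have rf : reflexive (fun i j : 'I_n => i <= j)%N by move=> ?; apply: leqnn.
have ltj : (index j (word w) < size (word w))%N by rewrite index_mem.
have nz : (0 < size (word w))%N := leq_ltn_trans (leq0n _) ltj.
rewrite -(nth_index i0 jw).
by apply/andP; split; apply: (sorted_leq_nth tr rf i0 srt); rewrite ?inE //; lia.
Qed.

End Words.

Section Ribbon.
Variables (m : nat) (alpha : m.+1.-tuple nat).
Hypothesis alpha_gt0 : forall a, (0 < tnth alpha a)%N.

Let c := (\sum_(b < m.+1) (tnth alpha b).-1).+1.

(** The column of the leftmost cell of row a. *)
Definition offset (a : nat) := (\sum_(b < m.+1 | b < a) (tnth alpha b).-1)%N.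

Lemma in_ribbon i j : ((i, j) \in ribbon alpha) =
  (offset (rev_ord i) <= j <= offset (rev_ord i).+1)%N.
Proof. by rewrite inE. Qed.

Lemma offset_mono a b : (a <= b)%N -> (offset a <= offset b)%N.
Proof.
move=> ab; rewrite /offset [leqRHS](bigID (fun i : 'I_m.+1 => i < a)%N) /=.
apply: leq_trans (leq_addr _ _); apply/eq_leq/eq_bigl => i.
by rewrite andbC; case: ltnP => //= ia; rewrite (leq_trans ia ab).
Qed.

Lemma offset_max a : (offset a < c)%N.
Proof.
by rewrite ltnS /offset [leqRHS](bigID (fun i : 'I_m.+1 => i < a)%N) leq_addr.
Qed.

Lemma offsetS (a : 'I_m.+1) : offset a.+1 = (offset a + (tnth alpha a).-1)%N.
Proof.
rewrite /offset (bigD1 a) //= addnC; congr (_ + _)%N; apply: eq_bigl => i.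
by rewrite ltnS -val_eqE /= ltn_neqAle andbC.
Qed.

(** Row a meets the columns offset a, ..., offset a + alpha_a - 1. *)
Lemma big_ribbon_row (T : Type) (idx : T) (op : Monoid.law idx) (a : 'I_m.+1)
    (F : nat -> T) :
  \big[op/idx]_(j < c | (rev_ord a, j) \in ribbon alpha) F j =
  \big[op/idx]_(i < tnth alpha a) F (offset a + i)%N.
Proof.
rewrite (eq_bigl (fun j : 'I_c =>
  (true && (j < (offset a.+1).+1)) && (offset a <= j))%N); last first.
  by move=> j; rewrite in_ribbon rev_ordK andbC.
rewrite -(big_geq_mkord _ _ (fun j => true && (j < (offset a.+1).+1)%N)).
rewrite -(big_nat_widen _ _ _ xpredT) ?offset_max //.
rewrite -{1}[offset a]add0n big_addn offsetS -addnS addKn prednK //.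
by rewrite big_mkord; apply: eq_bigr => i _; rewrite addnC.
Qed.

Section Elements.
Variables (k : comNzRingType) (n : nat).
Implicit Types t : tpow k n m.+1.

(** Rows a and a + 1 share the column offset a.+1. *)
Lemma schur_fuse t (a : 'I_m) : schur (ribbon alpha) t -> relabel (fuse a) t = 0.
Proof.
apply: (@span_min _ _ _ (fun t => relabel (fuse a) t = 0)).
  split=> [|x y z y0 z0]; first by rewrite raddf0.
  by rewrite raddfD /= linearZ /= y0 z0 scaler0 addr0.
move=> _ [v ->]; rewrite rmorph_prod.
pose j : 'I_c := Ordinal (offset_max a.+1).
rewrite (bigD1 j) //= (relabel_antisym (a := rev_ord (below a))
  (b := rev_ord (lift ord0 a))) ?mul0r //.
- by rewrite (inj_eq rev_ord_inj) eq_sym lift_neq_below.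
- by rewrite !rev_ordK fuse_below fuse_lift.
- by rewrite in_ribbon rev_ordK /= leqnn offset_mono.
- by rewrite in_ribbon rev_ordK /= leqnn offset_mono.
Qed.

Lemma schur_deg t : schur (ribbon alpha) t ->
  supported (fun u => forall a, mdeg (rowm u a) = tnth alpha a) t.
Proof.
apply: span_min; first exact: supported_submodule.
move=> _ [v ->].
pose degv j := @antisym_deg k n _ _ _ j (v j).
apply: (supported_sub _ (supported_rowdeg_prod degv)) => u degu a.
rewrite degu (eq_bigr (fun j : 'I_c =>
  if (rev_ord a, j) \in ribbon alpha then 1%N else 0%N)) => [|j _].
  rewrite -big_mkcond (big_ribbon_row _ _ (fun=> 1%N)) sum1_card.
  by rewrite cardT size_enum_ord.
by case: (_ \in _).
Qed.

(** The filling of the ribbon by the rows of u, each in increasing order, has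
    columns that strictly increase from top to bottom: two adjacent cells of a
    column are the last cell of a row and the first cell of the row above it,
    so that the descents of u apply. *)
Lemma ribbon_tableau (u : 'X_{1..m.+1 * n}) :
    (forall a, mdeg (rowm u a) = tnth alpha a) -> (forall a, descent a u) ->
  exists2 t : tpow k n m.+1, schur (ribbon alpha) t & leads (@wt n m.+1) u t.
Proof.
move=> degu desc.
have i0 : 'I_n.
  have := degu ord0; have := alpha_gt0 ord0.
  case: (n) (rowm u ord0) => [|n' w _ _]; last exact: ord0.
  by move=> w + /esym eqd; rewrite eqd mdegE big_ord0.
pose entry a j := nth i0 (word (rowm u a)) (j - offset a).
have col_adj (a : 'I_m) (j : nat) : (offset (below a) <= j <= offset (below a).+1)%N ->
    (offset (lift ord0 a) <= j <= offset (lift ord0 a).+1)%N ->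
    (entry (lift ord0 a) j < entry (below a) j)%N.
  rewrite lift0 => /andP[_ j_le] /andP[j_ge _].
  have -> : j = offset (below a).+1 by apply/eqP; rewrite eqn_leq j_le.
  have /descentP[i [i' [lt_i ui ui']]] := desc a.
  have /andP[_ le_i] := word_bounds i0 ui; have /andP[le_i' _] := word_bounds i0 ui'.
  rewrite /entry lift0 subnn (offsetS (below a)) addKn -degu.
  by apply: leq_ltn_trans le_i' _; apply: leq_trans lt_i _.
have col_strict (j : nat) (a b : 'I_m.+1) : (a < b)%N ->
    (offset a <= j <= offset a.+1)%N -> (offset b <= j <= offset b.+1)%N ->
    (entry b j < entry a j)%N.
  move=> ab aj; move: {2}(b - a)%N (leqnn (b - a)) => e.
  elim: e b ab => [|e IHe] b ab le_e bj; first by lia.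
  have lt_b' : (b.-1 < m)%N by have := ltn_ord b; lia.
  pose b' : 'I_m := Ordinal lt_b'.
  have eqb : b = lift ord0 b' by apply: val_inj; rewrite /= /bump /=; lia.
  have b'j : (offset (below b') <= j <= offset (below b').+1)%N.
    have eqb' : (below b').+1 = b by rewrite /=; lia.
    have ab' : (a.+1 <= b)%N by [].
    have := offset_mono ab'; have : (below b' <= b)%N by rewrite /=; lia.
    by move=> /offset_mono; rewrite eqb'; lia.
  have := col_adj b' j b'j; rewrite -eqb => /(_ bj) lt_adj.
  have [ab'|ab'] := ltnP a (below b').
    by apply: ltn_trans lt_adj (IHe _ ab' _ b'j); rewrite /=; lia.
  have -> : a = below b' by apply: val_inj => /=; move: ab' => /=; lia.
  exact: lt_adj.
pose v (j : 'I_c) (s : 'I_#|column (ribbon alpha) j|) : 'rV[k]_n :=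
  \row_i (i == entry (rev_ord (enum_val s)) j)%:R.
exists (\prod_(j < c) antisym (v j)); first by apply: span_gen; exists v.
have -> : u = (\sum_(j < c) \sum_(s < #|column (ribbon alpha) j|)
    U_(mxvec_index (rev_ord (enum_val s)) (entry (rev_ord (enum_val s)) j)))%MM.
  apply: rowm_inj => a; rewrite rowm_sum.
  rewrite (eq_bigr (fun j : 'I_c => if (rev_ord a, j) \in ribbon alpha
      then U_(entry a j) else 0)%MM) => [|j _].
    rewrite -big_mkcond (big_ribbon_row _ _ (fun j => U_(entry a j)%MM)).
    rewrite -[LHS]word_sum (big_nth i0) size_word degu big_mkord.
    by apply: eq_bigr => i _; rewrite /entry addKn.
  rewrite rowm_sum; under eq_bigr => s _ do rewrite rowmU.
  rewrite -(big_enum_val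
    (fun i => if rev_ord i == a then U_(entry (rev_ord i) j) else 0)%MM).
  rewrite (eq_bigr (fun i => if i == rev_ord a then U_(entry a j) else 0)%MM) => [|i _].
    by rewrite -big_mkcondr big_mem_pred1 inE.
  by rewrite (can2_eq rev_ordK rev_ordK); case: eqP => // ->; rewrite rev_ordK.
apply: leads_prod => [|j]; first exact: wtD.
rewrite antisym_det.
have -> : (\matrix_(t, s) place (rev_ord (enum_val t)) (linear_form (v j s))) =
    \matrix_(t, s) var (rev_ord (enum_val t)) (entry (rev_ord (enum_val s)) j)
    :> 'M[tpow k n m.+1]_#|column (ribbon alpha) j|.
  apply/matrixP => t s; rewrite !mxE linear_form_delta.
  by rewrite /place comp_mpolyXU -tnth_nth tnth_mktuple.
have rev_lt (s t : 'I_#|column (ribbon alpha) j|) :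
    (s < t)%N -> (rev_ord (enum_val t) < rev_ord (enum_val s))%N.
  move=> /enum_val_mono lt_st /=; apply: ltn_sub2l => //.
  exact: leq_ltn_trans lt_st (ltn_ord _).
apply: (leads_det (x := fun s => entry _ _)) => s t lt_st; first exact: rev_lt.
apply: col_strict; first exact: rev_lt.
  by rewrite -in_ribbon; have := enum_valP t; rewrite inE.
by rewrite -in_ribbon; have := enum_valP s; rewrite inE.
Qed.

End Elements.
End Ribbon.

(** * Fusions, the differentials and GL(V) *)

Section Complex.
Variables (k : comNzRingType) (n : nat).

Lemma relabel_id m (t : tpow k n m) : relabel id t = t.
Proof.
rewrite [t]mpolyE [relabel id _]raddf_sum; apply: eq_bigr => u _ /=.
rewrite linearZ /= relabelX; congr (_ *: 'X_[_]); apply: rowm_inj => a.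
by rewrite rowm_push big_pred1_eq.
Qed.

Lemma ribbon_diff_fuse m (t : tpow k n m.+2) : ribbon_diff t = relabel (fuse ord0) t.
Proof.
congr (subst _ t); apply/matrixP => a j; rewrite !mxE; congr (var _ j).
apply: val_inj; rewrite /= fuseE; case: unliftP => [b|] -> //=.
by rewrite /bump /= add1n subn1.
Qed.

Lemma fuse_tcons m (a : 'I_m) s (t : tpow k n m.+1) :
  relabel (fuse (lift ord0 a)) (tcons s t) = tcons s (relabel (fuse a) t).
Proof.
rewrite /tcons rmorphM /= relabel_place !shiftE !relabel_comp; congr (place _ s * _).
  by apply: val_inj; rewrite /= fuseE.
by apply: eq_relabel => b; apply: val_inj; rewrite /= fuseE /= fuseE /= /bump /=; lia.
Qed.

Lemma ribbon_diff_tcons m s (t : tpow k n m.+1) : ribbon_diff (tcons s t) = lscale s t.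
Proof.
rewrite ribbon_diff_fuse /tcons rmorphM /= relabel_place shiftE relabel_comp.
congr (place _ s * _); first by apply: val_inj; rewrite /= fuseE.
rewrite -[RHS]relabel_id; apply: eq_relabel => a.
by apply: val_inj; rewrite /= fuseE /= /bump /=; lia.
Qed.

(** The inclusion of S as its own first tensor power only renames monomials,
    so that statements about mult_map follow from those about ribbon_diff. *)
Lemma place_coef (p : sym k n) (u : 'X_{1..1 * n}) :
  (place ord0 p : tpow k n 1)@_u = p@_(rowm u ord0).
Proof.
have -> : place ord0 p = tcons p 1 :> tpow k n 1.
  by rewrite /tcons shiftE rmorph1 mulr1.
rewrite tcons_coef mcoeff1; have -> : utail u = 0%MM by apply: rowm_inj => -[].
by rewrite eqxx mulr1.
Qed.

Lemma supported_place0 (P : 'X_{1..n} -> Prop) (p : sym k n) :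
  supported P p <-> supported (fun u => P (rowm u ord0)) (place ord0 p : tpow k n 1).
Proof.
split=> Pp u; rewrite mcoeff_msupp; first by rewrite place_coef -mcoeff_msupp => /Pp.
rewrite -(rowm_ofrows (fun=> u) (ord0 : 'I_1)) -place_coef -mcoeff_msupp.
exact: Pp.
Qed.

Lemma place0_inj : injective (@place k n 1 ord0).
Proof.
move=> p q pq; apply/mpolyP => u.
by rewrite -(rowm_ofrows (fun=> u) (ord0 : 'I_1)) -!place_coef pq.
Qed.

Lemma place0_surj (t : tpow k n 1) : exists p, t = place ord0 p.
Proof.
exists (\sum_(u <- msupp t) t@_u *: 'X_[rowm u ord0]).
rewrite [LHS]mpolyE [RHS]raddf_sum; apply: eq_bigr => u _ /=.
rewrite linearZ /= placeX; congr (_ *: 'X_[_]); apply: rowm_inj => a.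
by rewrite rowm_ofrows ord1.
Qed.

Lemma place_mult_map (t : tpow k n 2) : place ord0 (mult_map t) = ribbon_diff t.
Proof.
rewrite [t]mpolyE /mult_map [subst _ _]raddf_sum [RHS]raddf_sum [LHS]raddf_sum.
apply: eq_bigr => u _ /=; rewrite !linearZ /= -/(ribbon_diff _); congr (_ *: _).
rewrite -(ucons_utail u) -tconsX ribbon_diff_tcons.
have -> : 'X_[utail u] = place ord0 'X_[rowm (utail u) ord0] :> tpow k n 1.
  rewrite placeX; congr 'X_[_]; apply: rowm_inj => a.
  by rewrite rowm_ofrows ord1.
by rewrite -/(mult_map _) mult_mapE rmorphM.
Qed.

Lemma gl_act_place g m (a : 'I_m) (s : sym k n) :
  gl_act g (place a s : tpow k n m) = place a (gl_sym g s).
Proof.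
have place_tens (p : sym k n) :
    place a p = tens (fun b => if b == a then p else 1) :> tpow k n m.
  rewrite /tens (bigD1 a) //= eqxx big1 ?mulr1 // => b /negPf->.
  by rewrite rmorph1.
rewrite !place_tens gl_tens; apply: eq_bigr => b _.
by case: eqP => // _; rewrite /gl_sym comp_mpoly1.
Qed.

Lemma gl_sym_deg g v :
  supported (fun w => mdeg w = mdeg v) (gl_sym g 'X_[k, v] : sym k n).
Proof.
rewrite /gl_sym comp_mpolyX.
have /= := @supported_prod k n unit (fun=> @mdeg n) _ (index_enum 'I_n)
  (fun j _ => v j) (fun j => tnth [tuple \sum_(i < n) g i j *: 'X_i | j < n] j ^+ v j).
rewrite -mdegE => degv; apply: supported_sub (degv _ _ _) => // [w /(_ tt)|_|_|j] //.
- exact: mdeg0.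
- exact: mdegD.
rewrite tnth_mktuple; apply: (@supported_sub _ _ (fun w => mdeg w = v j)) => // {degv}.
apply/dhomog_supported.
suff lin : \sum_(i < n) g i j *: 'X_i \is 1.-homog.
  by have := dhomogMn (v j) lin; rewrite mul1n.
apply/dhomog_supported; apply: submodule_sum (supported_submodule k _) _ => i _.
by apply: submoduleZ (supported_submodule k _) _; apply: supportedX; rewrite mdeg1.
Qed.

Lemma gl_act_deg g m (u : 'X_{1..m * n}) :
  supported (fun w => forall a, mdeg (rowm w a) = mdeg (rowm u a))
    (gl_act g 'X_[k, u] : tpow k n m).
Proof.
rewrite mpolyX_rows gl_tens /tens.
have degu (b : 'I_m) : supported (fun w => forall a, mdeg (rowm w a) =
    if a == b then mdeg (rowm u b) else 0%N)
    (place b (gl_sym g 'X_[rowm u b]) : tpow k n m).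
  apply: (supported_place _ (@gl_sym_deg g (rowm u b))) => v degv a.
  by rewrite rowm_ofrows; case: eqP; rewrite ?mdeg0.
apply: (supported_sub _ (supported_rowdeg_prod degu)) => w degw a.
by rewrite degw -big_mkcond (big_pred1 a) // => b; rewrite /= eq_sym.
Qed.

Lemma submnm_between (v w : 'X_{1..n}) e : (v <= w)%MM ->
    (mdeg v <= e <= mdeg w)%N ->
  exists x : 'X_{1..n}, [/\ (v <= x)%MM, (x <= w)%MM & mdeg x = e].
Proof.
move=> vw; elim: e => [|e IHe] /andP[].
  rewrite leqn0 => /eqP v0 _; exists v; split=> //; exact/mnm_lepP.
rewrite leq_eqVlt => /orP[/eqP ve _|ve ew].
  by exists v; split=> //; apply/mnm_lepP.
have [|x [vx xw xe]] := IHe; first by rewrite -ltnS ve ltnW.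
have [i lt_i]: exists i, (x i < w i)%N.
  apply/existsP; apply: contraLR ew => /existsPn ge; rewrite -leqNgt -xe.
  by rewrite !mdegE; apply: leq_sum => i _; rewrite leqNgt ge.
exists (x + U_(i))%MM; split.
- by apply/mnm_lepP => j; rewrite mnmDE (leq_trans (elimT mnm_lepP vx j)) ?leq_addr.
- apply/mnm_lepP => j; rewrite mnmDE mnm1E; case: eqP => [<-|_]; first by rewrite addn1.
  by rewrite addn0; apply: (elimT mnm_lepP xw).
- by rewrite mdegD mdeg1 xe addn1.
Qed.

End Complex.

(** * The resolution *)

Section Composition.
Variables (d r : nat).
Hypotheses (d_gt0 : (0 < d)%N) (r_gt0 : (0 < r)%N).

Lemma comp_dr_max i : tnth (comp_dr d i r) ord_max = r.
Proof. by rewrite (tnth_nth 0%N) /= nth_rcons size_nseq ltnn eqxx. Qed.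

Lemma comp_dr_lt i (a : 'I_i.+1) : (a < i)%N -> tnth (comp_dr d i r) a = d.
Proof. by move=> ai; rewrite (tnth_nth 0%N) /= nth_rcons size_nseq ai nth_nseq ai. Qed.

Lemma comp_dr_gt0 i a : (0 < tnth (comp_dr d i r) a)%N.
Proof.
have [/comp_dr_lt->//|ia] := ltnP a i; have -> : a = ord_max.
  by apply: val_inj => /=; have := ltn_ord a; lia.
by rewrite comp_dr_max.
Qed.

Lemma comp_dr_lift i a : tnth (comp_dr d i.+1 r) (lift ord0 a) = tnth (comp_dr d i r) a.
Proof. by rewrite !(tnth_nth 0%N) lift0. Qed.

Lemma comp_dr_sum i : (\sum_a tnth (comp_dr d i r) a = d * i + r)%N.
Proof.
rewrite big_ord_recr /= comp_dr_max; congr (_ + _)%N.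
rewrite (eq_bigr (fun=> d)) => [|a _]; last by rewrite comp_dr_lt /=.
by rewrite sum_nat_const card_ord mulnC.
Qed.

End Composition.

Section Resolution.
Variables (k : comNzRingType) (n d r : nat).
Hypotheses (d_gt0 : (0 < d)%N) (r_gt0 : (0 < r)%N).

Lemma veronese_submodule : submodule (@veronese k n d).
Proof. exact: supported_submodule. Qed.

Lemma veroneseM (s s' : sym k n) : veronese d s -> veronese d s' -> veronese d (s * s').
Proof.
apply: supportedM => u v u0 v0; rewrite mdegD -modnDm u0 v0 mod0n addn0.
by rewrite mod0n.
Qed.

Lemma veroneseX v : (mdeg v = 0 %[mod d])%N -> veronese d ('X_[v] : sym k n).
Proof. by move=> v0 u; rewrite msuppX inE => /eqP->. Qed.

Definition res_deg i (u : 'X_{1..i.+2 * n}) : Prop :=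
  (mdeg (rowm u ord0) = 0 %[mod d])%N /\
  forall a : 'I_i.+1, mdeg (rowm u (lift ord0 a)) = tnth (comp_dr d i r) a.

(** The terms of the complex in terms of fusions, see res_termE.  These conditions,
    unlike the generators of the terms, are visibly stable under the
    differential and under GL(V). *)
Definition res_ker i (t : tpow k n i.+2) : Prop :=
  supported (@res_deg i) t /\
  forall a : 'I_i, relabel (fuse (lift ord0 a)) t = 0.

Lemma res_ker_submodule i : submodule (@res_ker i).
Proof.
split=> [|c t t' [degt t0] [degt' t0']].
  by split=> [|a]; [exact: (supported_submodule k _).1 | rewrite raddf0].
split=> [|a]; first exact: (supported_submodule k _).2.
by rewrite raddfD /= linearZ /= t0 t0' scaler0 addr0.
Qed.

Lemma tcons_ker i s w : veronese d s -> schur (ribbon (comp_dr d i r)) w ->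
  @res_ker i (tcons s w).
Proof.
move=> Rs Ww; have alpha_gt0 := @comp_dr_gt0 d r d_gt0 r_gt0 i; split=> [|a].
  apply: (supported_tcons _ Rs (schur_deg alpha_gt0 Ww)) => v u degv degu.
  by split=> [|a]; rewrite ?rowm_ucons0 ?rowm_ucons.
by rewrite fuse_tcons (schur_fuse _ Ww) // /tcons shiftE rmorph0 mulr0.
Qed.

Lemma res_term_ker i t : res_term d r t -> @res_ker i t.
Proof.
apply: span_min; first exact: res_ker_submodule.
by move=> _ [s [w [Rs Ww ->]]]; apply: tcons_ker.
Qed.

Definition tableau i (w : 'X_{1..i.+1 * n}) : bool :=
  [forall a, mdeg (rowm w a) == tnth (comp_dr d i r) a] &&
  [forall a : 'I_i, descent a w].

Lemma tableauP i (w : 'X_{1..i.+1 * n}) :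
  reflect ((forall a, mdeg (rowm w a) = tnth (comp_dr d i r) a) /\
           forall a : 'I_i, descent a w) (tableau w).
Proof.
apply: (iffP andP) => -[].
  by move=> /forallP degw /forallP desc; split=> // a; apply/eqP.
by move=> degw desc; split; apply/forallP => // a; apply/eqP.
Qed.

Lemma tableau_schur i (w : 'X_{1..i.+1 * n}) : tableau w ->
  exists2 t : tpow k n i.+1,
    schur (ribbon (comp_dr d i r)) t & leads (@wt n i.+1) w t.
Proof. by case/tableauP; apply: ribbon_tableau => a; apply: comp_dr_gt0. Qed.

Lemma descent_utail m (a : 'I_m) (u : 'X_{1..m.+2 * n}) :
  descent (lift ord0 a) u = descent a (utail u).
Proof.
rewrite /descent !rowm_utail; have -> // : below (lift ord0 a) = lift ord0 (below a).
exact: val_inj.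
Qed.

(** The T j enumerate the tableaux of shape (d^i, r) through their monomials. *)
Record tableau_basis i N (T : 'I_N -> 'X_{1..i.+1 * n}) (e : 'I_N -> tpow k n i.+1) :=
  TableauBasis {
    tb_inj : injective T;
    tb_schur : forall j, schur (ribbon (comp_dr d i r)) (e j);
    tb_leads : forall j, leads (@wt n i.+1) (T j) (e j);
    tb_all : forall w, tableau w -> exists j, T j = w }.

Lemma tableau_basis_exists i : exists N T e, @tableau_basis i N T e.
Proof.
have [B Bdeg] : exists B, forall w : 'X_{1..i.+1 * n}, tableau w -> (mdeg w < B)%N.
  exists (d * i + r).+1 => w /tableauP[degw _].
  by rewrite mdeg_rows (eq_bigr _ (fun a _ => degw a)) comp_dr_sum.
pose A := [set w : bmultinom (i.+1 * n) B | tableau (w : 'X_{1..i.+1 * n})].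
pose T (j : 'I_#|A|) : 'X_{1..i.+1 * n} := enum_val j.
have tabT j : tableau (T j) by have := enum_valP j; rewrite inE.
have [e We le] := fin_all_exists2 (fun j => tableau_schur (tabT j)).
exists #|A|, T, e; split=> // [j j' /val_inj/enum_val_inj//|w tabw].
pose w' : bmultinom (i.+1 * n) B := BMultinom (Bdeg w tabw).
have wA : w' \in A by rewrite inE.
by exists (enum_rank_in wA w'); rewrite /T enum_rankK_in.
Qed.

Section Basis.
Variables (i N : nat) (T : 'I_N -> 'X_{1..i.+1 * n}) (e : 'I_N -> tpow k n i.+1).
Hypothesis Te : tableau_basis T e.

(** Straightening with S as coefficients: as the fusion of the coefficient row
    with the next one need not vanish, leading monomials have descents only
    between the other rows, which form a tableau. *)
Lemma tcons_coords t : @res_ker i t ->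
  exists2 c : 'I_N -> sym k n, (forall j, veronese d (c j)) &
    t = \sum_j tcons (c j) (e j).
Proof.
pose G (t : tpow k n i.+2) := exists v j,
  (mdeg v = 0 %[mod d])%N /\ t = tcons 'X_[v] (e j).
move=> kert; have: span G t.
  move: t kert; apply: (@straighten k _ (@wt n i.+2) _ G
    (fun u => (mdeg (rowm u ord0) = 0 %[mod d])%N /\ tableau (utail u))).
  - exact: res_ker_submodule.
  - move=> _ [v [j [v0 ->]]]; apply: tcons_ker; last exact: (tb_schur Te).
    exact: veroneseX.
  - move=> t u [degt t0] tu maxu; have [u0 degu] := degt u tu; split=> //.
    apply/tableauP; split=> a; first by rewrite rowm_utail.
    rewrite -descent_utail; apply: (descent_max (t0 a) tu maxu) => v tv.
    by rewrite degu; case: (degt v tv).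
  - move=> u [u0 tabu]; have [j Tj] := tb_all Te tabu.
    exists (tcons 'X_[rowm u ord0] (e j)); first by exists (rowm u ord0), j.
    by rewrite -{1}(ucons_utail u) -Tj; apply: leads_tcons; apply: (tb_leads Te).
apply: (@span_min _ _ _ (fun t => exists2 c : 'I_N -> sym k n,
    (forall j, veronese d (c j)) & t = \sum_j tcons (c j) (e j))).
  split=> [|a _ _ [c Rc ->] [c' Rc' ->]].
    exists (fun=> 0) => [j u|]; first by rewrite msupp0.
    by rewrite big1 // => j _; rewrite /tcons rmorph0 mul0r.
  exists (fun j => a *: c j + c' j) => [j|].
    exact: veronese_submodule.2.
  rewrite scaler_sumr -big_split; apply: eq_bigr => j _ /=.
  by rewrite tconsDl tconsZl.
move=> _ [v [j [v0 ->]]]; exists (fun j' => if j' == j then 'X_[v] else 0).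
  by move=> j'; case: eqP => _; [apply: veroneseX | move=> u; rewrite msupp0].
rewrite (bigD1 j) //= eqxx big1 ?addr0 // => j' /negPf->.
by rewrite /tcons rmorph0 mul0r.
Qed.

Lemma tcons_free (c : 'I_N -> sym k n) v :
    (forall w, (\sum_j tcons (c j) (e j))@_(ucons v w) = 0) ->
  forall j, (c j)@_v = 0.
Proof.
move=> sum0; apply: (leads_free (tb_inj Te) (tb_leads Te)) => w.
rewrite -[RHS](sum0 w) raddf_sum; apply: eq_bigr => j _ /=.
by rewrite tcons_coef rowm_ucons0 utail_ucons.
Qed.

Lemma res_termP t : res_term d r t <-> @res_ker i t.
Proof.
split=> [|/tcons_coords[c Rc ->]]; first exact: res_term_ker.
apply: submodule_sum => [|j _]; first exact: span_submodule.
by apply: span_gen; exists (c j), (e j); split=> //; apply: (tb_schur Te).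
Qed.

Lemma tcons_basis : is_basis d (@res_term k n d r i) (fun j => tcons 1 (e j)).
Proof.
have lscale1 (c : 'I_N -> sym k n) :
    \sum_j lscale (c j) (tcons 1 (e j)) = \sum_j tcons (c j) (e j).
  by apply: eq_bigr => j _; rewrite lscale_tcons mulr1.
split=> [t|c _]; last first.
  rewrite lscale1 => sum0 j; apply/mpolyP => v; rewrite mcoeff0.
  by apply: tcons_free => w; rewrite sum0 mcoeff0.
split=> [/res_term_ker/tcons_coords[c Rc ->]|[c Rc ->]].
  by exists c.
rewrite lscale1; apply/res_termP; apply: submodule_sum => [|j _].
  exact: res_ker_submodule.
by apply: tcons_ker; last apply: (tb_schur Te).
Qed.

Lemma tcons_homog j : tcons 1 (e j) \is (d * i + r).-homog.
Proof.
apply/dhomog_supported.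
have degT := schur_deg (@comp_dr_gt0 d r d_gt0 r_gt0 i) (tb_schur Te j).
have deg1 : supported (fun v => v = 0%MM) (1 : sym k n) by apply: supported1.
apply: (supported_tcons _ deg1 degT) => _ w -> degw.
rewrite mdeg_rows big_ord_recl rowm_ucons0 mdeg0 add0n -comp_dr_sum.
by apply: eq_bigr => a _; rewrite rowm_ucons.
Qed.

End Basis.

Lemma res_termE i t : @res_term k n d r i t <-> res_ker t.
Proof. by have [N [T [e Te]]] := tableau_basis_exists i; apply: res_termP Te t. Qed.

End Resolution.

(** * Exactness and minimality *)

Section Exactness.
Variables (k : comNzRingType) (n d r : nat).
Hypotheses (d_gt0 : (0 < d)%N) (r_gt0 : (0 < r)%N).
Local Notation res_ker i := (@res_ker k n d r i).
Local Notation res_term i := (@res_term k n d r i).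

Lemma ribbon_diff_ker i t : res_ker i.+1 t -> res_ker i (ribbon_diff t).
Proof.
case=> degt t0; rewrite ribbon_diff_fuse; split=> [|a].
  apply: supported_relabel degt => u [u0 degu]; split=> [|a].
    rewrite rowm_fuse mdegD degu (_ : below ord0 = ord0); last exact: val_inj.
    by rewrite (@comp_dr_lt d r i.+1 ord0) // modnDr u0.
  by rewrite rowm_fuse_lt // degu comp_dr_lift.
rewrite relabel_comp.
have fuseC := fuse_comp (leq0n (lift ord0 a) : (@ord0 i <= lift ord0 a)%N).
rewrite (_ : below ord0 = ord0) in fuseC; last exact: val_inj.
by rewrite (eq_relabel fuseC) -relabel_comp t0 raddf0.
Qed.

(** Fusing the first two rows twice fuses the first three, which can be done
    starting with the second and third. *)
Lemma ribbon_diff2 i t : res_ker i.+1 t -> ribbon_diff (ribbon_diff t) = 0.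
Proof.
case=> _ t0; rewrite !ribbon_diff_fuse relabel_comp.
have fuseC := fuse_comp (leqnn (@ord0 i)).
rewrite (_ : below ord0 = ord0) in fuseC; last exact: val_inj.
by rewrite (eq_relabel fuseC) -relabel_comp t0 raddf0.
Qed.

Lemma mdeg_sub (w x : 'X_{1..n}) : (w <= x)%MM -> (mdeg (x - w)%MM + mdeg w = mdeg x)%N.
Proof. by move=> wx; rewrite -mdegD submK. Qed.

(** The generators straightening the kernel are images: the coefficient row of
    a monomial u with descents everywhere has positive degree, hence degree at
    least d, and splitting off d of its variables, among them one of the
    descent, leaves a tableau with one more row. *)
Lemma ribbon_diff_tableau i (u : 'X_{1..i.+2 * n}) :
    @res_deg n d r i u -> (forall a : 'I_i.+1, descent a u) ->
  exists2 t, res_ker i.+1 t & leads (@wt n i.+2) u (ribbon_diff t).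
Proof.
move=> [u0 degu] desc; pose x := rowm u ord0.
have below0 : below ord0 = ord0 :> 'I_i.+2 by apply: val_inj.
have /descentP[j [j' [lt_j]]] := desc ord0; rewrite below0 -/x => xj uj'.
have dx : (d <= mdeg x)%N.
  apply: dvdn_leq; last by rewrite /dvdn -/x u0 mod0n.
  by rewrite lt0n mdeg_eq0; apply: contraTneq xj => ->; rewrite mnm0E.
have [||w [jw wx degw]] := @submnm_between n U_(j)%MM x d.
- by apply/mnm_lepP => l; rewrite mnm1E; case: eqP => // <-.
- by rewrite mdeg1 d_gt0.
have wj : (0 < w j)%N by have := elimT mnm_lepP jw j; rewrite mnm1E eqxx.
pose v := ucons w (utail u).
have [e We le]: exists2 e : tpow k n i.+2,
    schur (ribbon (comp_dr d i.+1 r)) e & leads (@wt n i.+2) v e.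
  apply: tableau_schur => //; apply/tableauP; split=> a.
    case: (unliftP ord0 a) => [b|] ->; last by rewrite rowm_ucons0 comp_dr_lt.
    by rewrite rowm_ucons rowm_utail degu comp_dr_lift.
  case: (unliftP ord0 a) (desc a) => [b|] -> descb.
    by rewrite descent_utail utail_ucons -descent_utail.
  apply/descentP; exists j, j'; rewrite below0 rowm_ucons0; split=> //.
  by rewrite rowm_ucons rowm_utail.
exists (tcons 'X_[(x - w)%MM] e).
  apply: tcons_ker => //; apply: veroneseX.
  by have := mdeg_sub wx; rewrite degw => degx; rewrite -modnDr degx.
rewrite ribbon_diff_tcons /lscale placeX.
set y := ofrows _; have -> : u = (y + v)%MM.
  apply: rowm_inj => a; rewrite rowmD rowm_ofrows.
  case: (unliftP ord0 a) => [b|] ->; last by rewrite eqxx rowm_ucons0 submK.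
  by rewrite add0m rowm_ucons rowm_utail.
by apply: leadsM => //; [exact: wtD | exact: leadsX].
Qed.

Lemma ribbon_diff_exact i t : res_ker i t -> ribbon_diff t = 0 ->
  exists2 u, res_ker i.+1 u & ribbon_diff u = t.
Proof.
move=> kert t0.
pose C t := res_ker i t /\ ribbon_diff t = 0.
pose G t := exists2 u, res_ker i.+1 u & ribbon_diff u = t.
have Gsub : submodule G.
  split=> [|c _ _ [u keru <-] [u' keru' <-]].
    by exists 0; [exact: (res_ker_submodule _ _ _ _ _).1 | exact: raddf0].
  exists (c *: u + u'); first exact: (res_ker_submodule _ _ _ _ _).2.
  by rewrite !ribbon_diff_fuse raddfD /= linearZ.
apply: (span_min Gsub (fun _ => id)).
apply: (@straighten k _ (@wt n i.+2) C G
  (fun u => @res_deg n d r i u /\ forall a : 'I_i.+1, descent a u)) (conj kert t0).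
- split=> [|c x y [kx x0] [ky y0]].
    by split; [exact: (res_ker_submodule _ _ _ _ _).1 | exact: raddf0].
  split; first exact: (res_ker_submodule _ _ _ _ _).2.
  move: x0 y0; rewrite !ribbon_diff_fuse raddfD /= linearZ /= => -> ->.
  by rewrite scaler0 addr0.
- move=> _ [u keru <-]; split; first exact: ribbon_diff_ker.
  exact: ribbon_diff2 keru.
- move=> p u [[degp p0] dp0] pu maxu; split=> [|a]; first exact: degp.
  have pa0 : relabel (fuse a) p = 0.
    case: (unliftP ord0 a) => [b|] -> //.
    by rewrite -ribbon_diff_fuse.
  apply: (descent_max pa0 pu maxu) => v pv.
  by rewrite (degp v pv).2 (degp u pu).2.
- move=> u [degu desc]; have [e kere le] := ribbon_diff_tableau degu desc.
  by exists (ribbon_diff e) => //; exists e.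
Qed.

(** A ribbon with one row allows no fusion, so that every monomial of degree r
    is the leading one of an element of the Schur module. *)
Lemma schur_row t : schur (ribbon (comp_dr d 0 r)) t <->
  exists2 p : sym k n, p \is r.-homog & t = place ord0 p.
Proof.
have alpha0 : tnth (comp_dr d 0 r) ord0 = r by rewrite (tnth_nth 0%N).
have alpha_gt0 := @comp_dr_gt0 d r d_gt0 r_gt0 0.
split=> [Wt|[p /dhomog_supported degp ->]].
  have [p eqt] := place0_surj t; exists p => //; apply/dhomog_supported.
  apply/supported_place0; rewrite -eqt; apply: supported_sub (schur_deg alpha_gt0 Wt).
  by move=> u ->.
apply: (span_min (span_submodule _) (fun _ => id)).
apply: (@straighten k _ (@wt n 1) (supported (fun u => mdeg (rowm u ord0) = r)) _
  (fun u => mdeg (rowm u ord0) = r)).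
- exact: supported_submodule.
- by move=> q Wq; apply: supported_sub (schur_deg alpha_gt0 Wq) => u ->.
- by move=> q u degq /degq.
- move=> u degu; apply: ribbon_tableau => // [a|[]//].
  by rewrite ord1 degu alpha0.
- exact: (supported_place0 (fun v => mdeg v = r) p).1 degp.
Qed.

Lemma mult_map_ge t : res_ker 0 t -> veronese_ge r d (mult_map t).
Proof.
case=> degt _.
apply/(supported_place0 (fun u => (r <= mdeg u)%N /\ (mdeg u = r %[mod d])%N)).
rewrite place_mult_map ribbon_diff_fuse; apply: supported_relabel degt => u [u0 degu].
rewrite rowm_fuse mdegD degu (_ : below ord0 = ord0); last exact: val_inj.
by rewrite (tnth_nth 0%N) /= leq_addl -modnDml u0 mod0n.
Qed.

(** A monomial of M has a divisor of degree r, and the cofactor lies in R. *)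
Lemma mult_map_surj p : veronese_ge r d p -> exists2 t, res_ker 0 t & mult_map t = p.
Proof.
move=> Mp; pose W (p : sym k n) := exists2 t, res_ker 0 t & mult_map t = p.
have Wsub : submodule W.
  split=> [|c _ _ [t kert <-] [t' kert' <-]].
    by exists 0; [exact: (res_ker_submodule _ _ _ _ _).1 | exact: raddf0].
  exists (c *: t + t'); first exact: (res_ker_submodule _ _ _ _ _).2.
  by rewrite /mult_map raddfD /= linearZ.
rewrite -/(W p) [p]mpolyE big_seq; apply: submodule_sum => // u /Mp[ru uM].
apply: submoduleZ => //.
have [||w [_ wu degw]] := @submnm_between n 0%MM u r.
- by apply/mnm_lepP => j; rewrite mnm0E.
- by rewrite mdeg0 ru.
exists (tcons 'X_[(u - w)%MM] (place ord0 'X_[w])).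
  apply: tcons_ker => //.
    apply: veroneseX; apply/eqP; rewrite -(eqn_modDr r).
    by have := mdeg_sub wu; rewrite degw => ->; apply/eqP.
  by apply/schur_row; exists 'X_[w] => //; rewrite dhomogX; apply/eqP.
by rewrite mult_mapE -mpolyXD submK.
Qed.

Lemma mult_map0 t : mult_map t = 0 <-> ribbon_diff t = 0 :> tpow k n 1.
Proof.
rewrite -place_mult_map; split=> [->|p0]; first by rewrite raddf0.
by apply: place0_inj; rewrite p0 raddf0.
Qed.

Lemma gl_act_ker g i t : res_ker i t -> res_ker i (gl_act g t).
Proof.
case=> degt t0; split=> [|a]; last by rewrite -gl_act_relabel t0 /gl_act raddf0.
rewrite [t]mpolyE /gl_act [subst _ _]raddf_sum big_seq.
apply: submodule_sum (supported_submodule k _) _ => u /degt[u0 degu] /=.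
rewrite linearZ /=; apply: submoduleZ (supported_submodule k _) _.
rewrite -/(gl_act g _).
by apply: supported_sub (@gl_act_deg k n g _ u) => w degw; split=> [|a]; rewrite degw.
Qed.

Lemma mult_map_gl g (t : tpow k n 2) : mult_map (gl_act g t) = gl_sym g (mult_map t).
Proof.
apply: place0_inj; rewrite place_mult_map -gl_act_place place_mult_map.
by rewrite !ribbon_diff_fuse gl_act_relabel.
Qed.

(** To the part of degree 0 in the coefficient row only the constant terms of
    the coordinates contribute, and the tableau basis is free over k. *)
Lemma coords_coef0 i N T (e : 'I_N -> tpow k n i.+1) (c : 'I_N -> sym k n) :
    @tableau_basis k n d r i N T e ->
    supported (fun u => rowm u ord0 != 0%MM) (\sum_j tcons (c j) (e j)) ->
  forall j, (c j)@_0 = 0.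
Proof.
move=> Te pos; apply: (tcons_free Te) => w; apply: memN_msupp_eq0.
by apply/negP => /pos; rewrite rowm_ucons0 eqxx.
Qed.

(** The coordinates of an image in the tableau basis have no constant terms, by
    coords_coef0.  To carry this over to an arbitrary basis b', the part of the
    coordinates that is constant is singled out: it gives a combination t of b'
    that still has positive degree in the coefficient row, and comparing its
    two expansions in b' shows its constant coefficients to lie in R_+. *)
Lemma res_minimal i N N' (b : 'I_N -> tpow k n i.+3) (b' : 'I_N' -> tpow k n i.+2)
    (A : 'M[sym k n]_(N, N')) :
    is_basis d (res_term i.+1) b -> is_basis d (res_term i) b' ->
    (forall j l, veronese d (A j l)) ->
    (forall j, ribbon_diff (b j) = \sum_(l < N') lscale (A j l) (b' l)) ->
  forall j l, veronese_ge d d (A j l).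
Proof.
move=> basb [genb' freeb'] RA diffb j.
suff A0 l : (A j l)@_0 = 0.
  move=> l u Au; have u0 := RA j l u Au; split; last by rewrite modnn u0 mod0n.
  apply: dvdn_leq; last by rewrite /dvdn u0 mod0n.
  rewrite lt0n mdeg_eq0; apply: contraTneq Au => ->.
  by rewrite mcoeff_msupp A0 eqxx.
have RC (c : k) : veronese d (c%:MP : sym k n).
  by move=> u; rewrite msuppC; case: eqP => // _; rewrite inE => /eqP->; rewrite mdeg0.
pose t := \sum_l lscale ((A j l)@_0)%:MP (b' l).
have kert : res_ker i t.
  by apply/(res_termE d_gt0 r_gt0 _)/genb'; exists (fun l => ((A j l)@_0)%:MP).
have [M [T [e Te]]] := @tableau_basis_exists k n d r d_gt0 r_gt0 i.
have [s Rs eq_t] := tcons_coords d_gt0 r_gt0 Te kert.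
(* t differs from the image of b j by terms with coefficients in R_+. *)
have s0 : forall m, (s m)@_0 = 0.
  apply: (coords_coef0 Te); rewrite -eq_t.
  have -> : t = ribbon_diff (b j) - \sum_l lscale (A j l - ((A j l)@_0)%:MP) (b' l).
    rewrite diffb -sumrB; apply: eq_bigr => l' _.
    by rewrite /lscale -mulrBl -raddfB opprB addrC subrK.
  apply: (submoduleB (supported_submodule k _)).
    have [degb _]: res_ker i.+1 (b j).
      apply/(res_termE d_gt0 r_gt0 _)/(basb.1 _); exists (fun j' => (j' == j)%:R).
        move=> j'; case: eqP => _; first by rewrite mulr1n -mpolyC1; apply: RC.
        by move=> u; rewrite mulr0n msupp0.
      rewrite (bigD1 j) //= eqxx /lscale rmorph1 mul1r big1 ?addr0 // => j' /negPf->.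
      by rewrite rmorph0 mul0r.
    rewrite ribbon_diff_fuse; apply: supported_relabel degb => u [_ degu].
    rewrite rowm_fuse -mdeg_eq0 mdegD degu comp_dr_lt // -lt0n.
    by rewrite ltn_addl.
  apply: submodule_sum (supported_submodule k _) _ => l' _.
  apply: (@supportedM _ _ (fun u => rowm u ord0 != 0%MM) (fun=> True)) => //.
    by move=> u v nz _; rewrite rowmD -mdeg_eq0 mdegD addn_eq0 mdeg_eq0 (negPf nz).
  apply: (@supported_place _ _ _ _ (fun u => u != 0%MM)).
    by move=> v nz; rewrite rowm_ofrows.
  move=> u; apply: contraTneq => ->.
  by rewrite mcoeff_msupp mcoeffB mcoeffC eqxx mulr1 subrr eqxx.
have coords m : exists B : 'I_N' -> sym k n, (forall l', veronese d (B l')) /\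
    tcons 1 (e m) = \sum_l' lscale (B l') (b' l').
  have : res_ker i (tcons 1 (e m)).
    by apply: tcons_ker (tb_schur Te m) => //; rewrite -mpolyC1; apply: RC.
  by move/(res_termE d_gt0 r_gt0 _)/genb' => [B RB ->]; exists B.
have [B RB] := fin_all_exists coords.
pose z l' := ((A j l')@_0)%:MP - \sum_m s m * B m l'.
have z0 : z l = 0.
  apply: (freeb' z) => [l'|].
    apply: (submoduleB (veronese_submodule _ _ _)) => //.
    apply: (submodule_sum _ (veronese_submodule _ _ _)) => m _.
    by apply: veroneseM => //; apply: (RB m).1.
  have -> : \sum_l' lscale (z l') (b' l') = t - \sum_m lscale (s m) (tcons 1 (e m)).
    rewrite (eq_bigr _ (fun m _ => congr1 (lscale (s m)) (RB m).2)).
    under [X in _ - X]eq_bigr => m _ do rewrite /lscale mulr_sumr.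
    rewrite exchange_big -sumrB; apply: eq_bigr => l' _.
    rewrite /lscale raddfB mulrBl raddf_sum; congr (_ - _).
    by rewrite mulr_suml; apply: eq_bigr => m _ /=; rewrite rmorphM mulrA.
  apply/eqP; rewrite subr_eq0 {1}eq_t; apply/eqP/eq_bigr => m _.
  by rewrite lscale_tcons mulr1.
have := congr1 (mcoeff 0%MM) z0; rewrite /z mcoeffB mcoeffC eqxx mulr1 mcoeff0.
rewrite raddf_sum big1 ?subr0 // => m _ /=.
by rewrite rmorphM /= s0 mul0r.
Qed.

End Exactness.

Theorem theorem4p4 (k : comNzRingType) (n d r : nat) :
  (0 < d)%N -> (0 < r)%N ->
  let F (i : nat) : tpow k n i.+2 -> Prop := @res_term k n d r i in
  let R : sym k n -> Prop := veronese d in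
  let M : sym k n -> Prop := veronese_ge r d in
  let Rplus : sym k n -> Prop := veronese_ge d d in
  (* S^sigma(r)(V) = S_r, so that F 0%N = R (x) S_r *)
  (forall t : tpow k n 1, schur (ribbon (comp_dr d 0 r)) t <->
     exists2 p : sym k n, p \is r.-homog & t = place ord0 p) /\
  (* F i is R-free with finite basis in degree d i + r *)
  (forall i, exists (N : nat) (b : 'I_N -> tpow k n i.+2),
     is_basis d (F i) b /\ forall j, b j \is (d * i + r).-homog) /\
  (* the differentials are well defined on the terms, R-linear, of degree 0 *)
  ((forall t, F 0%N t -> M (mult_map t)) /\
   (forall i t, F i.+1 t -> F i (ribbon_diff t))) /\
  ((forall s t u, R s -> F 0%N t -> F 0%N u ->
      mult_map (lscale s t + u) = s * mult_map t + mult_map u) /\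
   (forall i s t u, R s -> F i.+1 t -> F i.+1 u ->
      ribbon_diff (lscale s t + u) = lscale s (ribbon_diff t) + ribbon_diff u)) /\
  ((forall e t, F 0%N t -> t \is e.-homog -> mult_map t \is e.-homog) /\
   (forall i e t, F i.+1 t -> t \is e.-homog -> ribbon_diff t \is e.-homog)) /\
  (* exactness *)
  ((forall p, M p -> exists2 t, F 0%N t & mult_map t = p) /\
   (forall t, F 0%N t ->
      (mult_map t = 0 <-> exists2 u, F 1%N u & ribbon_diff u = t)) /\
   (forall i t, F i.+1 t ->
      (ribbon_diff t = 0 <-> exists2 u, F i.+2 u & ribbon_diff u = t))) /\
  (* GL(V)-equivariance *)
  (forall g : 'M[k]_n, isGL g ->
     (forall p, M p -> M (gl_sym g p)) /\
     (forall i t, F i t -> F i (gl_act g t)) /\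
     (forall t, F 0%N t -> mult_map (gl_act g t) = gl_sym g (mult_map t)) /\
     (forall i t, F i.+1 t ->
        ribbon_diff (gl_act g t) = gl_act g (ribbon_diff t))) /\
  (* minimality: the matrices of the differentials have entries in R_+ *)
  (forall i (N N' : nat) (b : 'I_N -> tpow k n i.+3)
          (b' : 'I_N' -> tpow k n i.+2) (A : 'M[sym k n]_(N, N')),
     is_basis d (F i.+1) b -> is_basis d (F i) b' ->
     (forall j l, R (A j l)) ->
     (forall j, ribbon_diff (b j) = \sum_(l < N') lscale (A j l) (b' l)) ->
     forall j l, Rplus (A j l)).
Proof.
move=> d_gt0 r_gt0 F R M Rplus.
have FE i t : F i t <-> res_ker d r t by exact: res_termE.
have exact_at i t : F i t ->
    (ribbon_diff t = 0 <-> exists2 u, F i.+1 u & ribbon_diff u = t).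
  move=> /FE kert; split=> [t0|[u /FE keru <-]]; last exact: ribbon_diff2 keru.
  have [u keru du] := ribbon_diff_exact d_gt0 r_gt0 kert t0.
  by exists u => //; apply/FE.
have homog_diff m e (t : tpow k n m.+2) : t \is e.-homog -> ribbon_diff t \is e.-homog.
  move=> /dhomog_supported degt; apply/dhomog_supported; rewrite ribbon_diff_fuse.
  by apply: supported_relabel degt => u <-; apply: mdeg_push.
split; first exact: schur_row.
split.
  move=> i; have [N [T [e Te]]] := @tableau_basis_exists k n d r d_gt0 r_gt0 i.
  exists N, (fun j => tcons 1 (e j)); split; first exact: tcons_basis Te.
  by move=> j; apply: tcons_homog Te j.
split.
  split=> [t /FE|i t /FE kert]; first exact: mult_map_ge.
  by apply/FE/ribbon_diff_ker.
split.
  split=> [s t u _ _ _|i s t u _ _ _].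
    apply: place0_inj; rewrite [RHS]raddfD /= rmorphM /= !place_mult_map.
    rewrite !ribbon_diff_fuse raddfD /= /lscale rmorphM /= relabel_place.
    by rewrite (_ : fuse ord0 ord0 = ord0) //; apply: ord1.
  rewrite !ribbon_diff_fuse raddfD /= /lscale rmorphM /= relabel_place.
  by rewrite (_ : fuse ord0 ord0 = ord0) //; apply: val_inj; rewrite /= fuseE.
split.
  split=> [e t _ /homog_diff|i e t _]; last exact: homog_diff.
  rewrite -place_mult_map => /dhomog_supported degt; apply/dhomog_supported.
  apply/supported_place0; apply: supported_sub degt => u.
  by rewrite mdeg_rows big_ord1.
split.
  split=> [p Mp|].
    by have [t kert <-] := mult_map_surj d_gt0 r_gt0 Mp; exists t => //; apply/FE.
  split=> [t Ft|i t]; last exact: exact_at.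
  by rewrite mult_map0; apply: exact_at.
split.
  move=> g _; split=> [p Mp|].
    have [t kert <-] := mult_map_surj d_gt0 r_gt0 Mp.
    by rewrite -mult_map_gl; apply/mult_map_ge/gl_act_ker.
  split=> [i t /FE kert|]; first by apply/FE/gl_act_ker.
  split=> [t _|i t _]; first exact: mult_map_gl.
  by rewrite !ribbon_diff_fuse gl_act_relabel.
by move=> i N N' b b' A; apply: res_minimal.
Qed.
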